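(* Let $\mathcal H$ be the complex Heisenberg Lie algebra with basis $e_1,e_2,e_3$ and only non-zero bracket $[e_1,e_2]=e_3$. For a representation of $\mathcal H$ given in one of the cases (BI)–(BVI) listed in the context, there exist bijective 1-cocycles if and only if it is equivalent to one of the representations listed below under the corresponding case. For each of these the bijective 1-cocycles, classified up to equivalence, and the corresponding left-symmetric algebras (non-zero products) are as follows. Case (BI): there does not exist any bijective 1-cocycle. Case (BII): (BII-1) $a=0,\ c=1,\ a'=c'=0$: $q=(-v_2+v_3,\ v_2,\ v_1)$, giving (H-3)': $e_1e_1=e_1+e_2$, $e_2e_1=-e_3$, $e_2e_2=e_3$, which is isomorphic to (H-3): $e_1e_1=e_1$, $e_1e_2=e_3$, $e_2e_2=e_3$. (BII-2) $a=c=0,\ a'=0,\ c'=1$: $q=(v_2,v_3,-v_1)$, giving (H-4)': $e_2e_1=-e_3$, $e_2e_2=e_2$, which is isomorphic to (H-4): $e_1e_1=e_1$, $e_1e_2=e_3$. (BII-3) $a=c=a'=c'=0$: $q=(v_2,v_3,-v_1)$, giving (H-5): $e_2e_1=-e_3$. Case (BIII): $a=a'=0$: $q=(v_2,v_3,-v_1)$, giving (H-6): $e_2e_1=-e_3$, $e_2e_2=e_1$. Case (BIV): $a=a'=0$: $q_\lambda=(v_2,\ v_2+\lambda v_3,\ v_1)$, $\lambda\neq0$, giving (H-7)$_\lambda$, $\lambda\ne0$: $e_1e_1=e_3$, $e_1e_2=e_3$, $e_2e_2=\lambda e_3$; and $q=(-\tfrac12v_3,\ \tfrac12 v_2,\ v_1)$,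 giving (H-8): $e_1e_2=\tfrac12e_3$, $e_2e_1=-\tfrac12e_3$. Case (BV): $a=a'=0$: $q=(v_1,v_3,v_2)$, giving (H-9): $e_1e_2=e_3$, $e_2e_2=e_1$. Case (BVI): $a=a'=0$: $q_\lambda=(v_2,\ \lambda v_3,\ (\lambda-1)v_1)$, $\lambda\ne0,1$, giving (H-10)$_\lambda$, $\lambda\neq0,1$: $e_1e_2=\frac{\lambda}{\lambda-1}e_3$, $e_2e_1=\frac1{\lambda-1}e_3$, $e_2e_2=\lambda e_1$.
   Context: $V$ has basis $v_1,v_2,v_3$; $E_{ij}\in gl(V)$ is the operator $v_i\mapsto v_j$, $v_k\mapsto0$ for $k\ne i$; $\mathrm{diag}(a,b,c)$ is $v_1\mapsto av_1,v_2\mapsto bv_2,v_3\mapsto cv_3$; $I$ is the identity. A linear map $q:\mathcal H\to V$ is written $q=(q(e_1),q(e_2),q(e_3))$. Cases of representations of $\mathcal H$ (with $f(e_3)=0$ and complex parameters): (BI) $f(e_1)=\mathrm{diag}(a,b,c)$, $f(e_2)=\mathrm{diag}(a',b',c')$; (BII) $f(e_1)=\mathrm{diag}(a,a,c)$, $f(e_2)=\mathrm{diag}(a',a',c')+E_{21}$; (BIII) $f(e_1)=aI$, $f(e_2)=a'I+E_{21}+E_{32}$; (BIV) $f(e_1)=aI+E_{21}$, $f(e_2)=a'I+E_{31}$; (BV) $f(e_1)=aI+E_{32}$, $f(e_2)=a'I+E_{31}$; (BVI) $f(e_1)=aI+E_{31}$, $f(e_2)=a'I+E_{21}+E_{32}$.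 A left-symmetric algebra is a vector space with a bilinear product satisfying $(xy)z-x(yz)=(yx)z-y(xz)$. For a representation $f:\mathcal G\to gl(V)$ of a Lie algebra, a 1-cocycle associated to $f$ is a linear map $q:\mathcal G\to V$ with $q([x,y])=f(x)q(y)-f(y)q(x)$; it is bijective if $q$ is a linear isomorphism. A bijective 1-cocycle $(f,q)$ gives the left-symmetric algebra $x*y=q^{-1}(f(x)q(y))$ on $\mathcal G$, whose commutator is the bracket of $\mathcal G$. Representations $(f_1,V_1),(f_2,V_2)$ are equivalent if $f_2(x)=g f_1(T(x))g^{-1}$ for some automorphism $T$ of $\mathcal G$ and linear isomorphism $g:V_1\to V_2$. Bijective 1-cocycles $(f_1,q_1),(f_2,q_2)$ are equivalent if there are such $T,g$ with $f_2(x)=g f_1(T(x))g^{-1}$ and $q_2=g q_1T$. *)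

(* Defs.v *)
From HB Require Import structures.
From mathcomp Require Import all_boot all_order all_algebra.
From mathcomp Require Import ring.

Set Implicit Arguments.
Unset Strict Implicit.
Unset Printing Implicit Defensive.

Import GRing.Theory.
Local Open Scope ring_scope.

Record lieAlgebra (K : fieldType) := LieAlgebra {
  lie_space :> vectType K;
  lie : lie_space -> lie_space -> lie_space;
  lie_linearl : forall y, linear (fun x => lie x y);
  lie_linearr : forall x, linear (lie x);
  lie_alt : forall x, lie x x = 0;
  lie_jacobi : forall x y z,
    lie x (lie y z) + lie y (lie z x) + lie z (lie x y) = 0
}.

Record representation (K : fieldType) (L : lieAlgebra K) (V : vectType K) :=
  Representation {
    rep_map :> 'Hom(L, 'End(V));
    rep_lie : forall x y : L,
      rep_map (lie x y)
      = (rep_map x \o rep_map y)%VF - (rep_map y \o rep_map x)%VF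
  }.

Section Cocycles.
Variables (K : fieldType) (L : lieAlgebra K).

Definition lie_automorphism (T : 'End(L)) : Prop :=
  bijective T /\ forall x y : L, T (lie x y) = lie (T x) (T y).

Definition cocycle (V : vectType K) (f : representation L V)
    (q : 'Hom(L, V)) : Prop :=
  forall x y : L, q (lie x y) = f x (q y) - f y (q x).

Definition bijective_cocycle (V : vectType K) (f : representation L V)
    (q : 'Hom(L, V)) : Prop :=
  cocycle f q /\ bijective q.

Definition rep_equiv (V1 V2 : vectType K)
    (f1 : representation L V1) (f2 : representation L V2) : Prop :=
  exists (T : 'End(L)) (g : 'Hom(V1, V2)),
    [/\ lie_automorphism T, bijective g
      & forall x : L, f2 x = (g \o f1 (T x) \o g^-1)%VF].

Definition cocycle_equiv (V1 V2 : vectType K)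
    (f1 : representation L V1) (q1 : 'Hom(L, V1))
    (f2 : representation L V2) (q2 : 'Hom(L, V2)) : Prop :=
  exists (T : 'End(L)) (g : 'Hom(V1, V2)),
    [/\ lie_automorphism T, bijective g,
        forall x : L, f2 x = (g \o f1 (T x) \o g^-1)%VF
      & q2 = (g \o q1 \o T)%VF].

(* [S] is a complete and irredundant set of representatives of the bijective
   1-cocycles associated to [f], up to equivalence. *)
Definition cocycle_classification (V : vectType K) (f : representation L V)
    (S : 'Hom(L, V) -> Prop) : Prop :=
  [/\ forall q, S q -> bijective_cocycle f q,
      forall q, bijective_cocycle f q ->
        exists2 q', S q' & cocycle_equiv f q f q'
    & forall q q', S q -> S q' -> cocycle_equiv f q f q' -> q = q'].

Definition left_symmetric (A : vectType K) (mul : A -> A -> A) : Prop :=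
  [/\ forall y, linear (fun x => mul x y),
      forall x, linear (mul x)
    & forall x y z, mul (mul x y) z - mul x (mul y z)
                    = mul (mul y x) z - mul y (mul x z)].

Definition lsa_isomorphic (A B : vectType K)
    (mulA : A -> A -> A) (mulB : B -> B -> B) : Prop :=
  exists2 phi : 'Hom(A, B), bijective phi
    & forall x y, phi (mulA x y) = mulB (phi x) (phi y).

Definition cocycle_mul (V : vectType K) (f : representation L V)
    (q : 'Hom(L, V)) (x y : L) : L :=
  (q^-1)%VF (f x (q y)).

Definition gives_lsa (V : vectType K) (f : representation L V)
    (q : 'Hom(L, V)) (mul : L -> L -> L) : Prop :=
  left_symmetric mul /\ forall x y, cocycle_mul f q x y = mul x y.

End Cocycles.

Definition i1 : 'I_3 := @Ordinal 3 0 isT.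
Definition i2 : 'I_3 := @Ordinal 3 1 isT.
Definition i3 : 'I_3 := @Ordinal 3 2 isT.

Section Heisenberg.
Variable K : fieldType.

Definition heis_lie (x y : 'rV[K]_3) : 'rV[K]_3 :=
  (x 0 i1 * y 0 i2 - x 0 i2 * y 0 i1) *: delta_mx 0 i3.

Lemma heis_linearl y : linear (fun x => heis_lie x y).
Proof.
move=> k x x'; rewrite /heis_lie scalerA -scalerDl !mxE; congr (_ *: _).
by ring.
Qed.

Lemma heis_linearr x : linear (heis_lie x).
Proof.
move=> k y y'; rewrite /heis_lie scalerA -scalerDl !mxE; congr (_ *: _).
by ring.
Qed.

Lemma heis_alt x : heis_lie x x = 0.
Proof. by rewrite /heis_lie mulrC subrr scale0r. Qed.

Lemma heis_jacobi x y z :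
  heis_lie x (heis_lie y z) + heis_lie y (heis_lie z x)
  + heis_lie z (heis_lie x y) = 0.
Proof.
have lie0 a b c : heis_lie a (heis_lie b c) = 0.
  by rewrite /heis_lie !mxE /= !mulr0 subrr scale0r.
by rewrite !lie0 !addr0.
Qed.

Definition heisenberg : lieAlgebra K :=
  LieAlgebra heis_linearl heis_linearr heis_alt heis_jacobi.

Definition e1 : heisenberg := delta_mx 0 i1 : 'rV[K]_3.
Definition e2 : heisenberg := delta_mx 0 i2 : 'rV[K]_3.
Definition e3 : heisenberg := delta_mx 0 i3 : 'rV[K]_3.

Lemma heis_lie12 : lie e1 e2 = e3.
Proof. by rewrite /= /heis_lie !mxE /= mulr1 mul0r subr0 scale1r. Qed.

(* The bilinear product on the Heisenberg algebra with e_i e_j = t i j; the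
   table [t] is indexed from 1. *)
Definition table_mul (t : nat -> nat -> heisenberg)
    (x y : heisenberg) : heisenberg :=
  \sum_(i < 3) \sum_(j < 3)
    ((x : 'rV[K]_3) 0 i * (y : 'rV[K]_3) 0 j) *: t i.+1 j.+1.

Definition H3' := table_mul (fun i j => match i, j with
  | 1%N, 1%N => e1 + e2
  | 2%N, 1%N => - e3
  | 2%N, 2%N => e3
  | _, _ => 0 end).

Definition H3 := table_mul (fun i j => match i, j with
  | 1%N, 1%N => e1
  | 1%N, 2%N => e3
  | 2%N, 2%N => e3
  | _, _ => 0 end).

Definition H4' := table_mul (fun i j => match i, j with
  | 2%N, 1%N => - e3
  | 2%N, 2%N => e2
  | _, _ => 0 end).

Definition H4 := table_mul (fun i j => match i, j with
  | 1%N, 1%N => e1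
  | 1%N, 2%N => e3
  | _, _ => 0 end).

Definition H5 := table_mul (fun i j => match i, j with
  | 2%N, 1%N => - e3
  | _, _ => 0 end).

Definition H6 := table_mul (fun i j => match i, j with
  | 2%N, 1%N => - e3
  | 2%N, 2%N => e1
  | _, _ => 0 end).

Definition H7 (l : K) := table_mul (fun i j => match i, j with
  | 1%N, 1%N => e3
  | 1%N, 2%N => e3
  | 2%N, 2%N => l *: e3
  | _, _ => 0 end).

Definition H8 := table_mul (fun i j => match i, j with
  | 1%N, 2%N => (2^-1 : K) *: e3
  | 2%N, 1%N => - (2^-1 : K) *: e3
  | _, _ => 0 end).

Definition H9 := table_mul (fun i j => match i, j with
  | 1%N, 2%N => e3
  | 2%N, 2%N => e1
  | _, _ => 0 end).

Definition H10 (l : K) := table_mul (fun i j => match i, j with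
  | 1%N, 2%N => (l / (l - 1)) *: e3
  | 2%N, 1%N => (l - 1)^-1 *: e3
  | 2%N, 2%N => l *: e1
  | _, _ => 0 end).

(* The linear map with e_i |-> x_i. *)
Section HeisMap.
Variables (W : vectType K) (x1 x2 x3 : W).

Definition heis_fun (x : heisenberg) : W :=
  let x : 'rV[K]_3 := x in x 0 i1 *: x1 + x 0 i2 *: x2 + x 0 i3 *: x3.

Lemma heis_fun_linear : linear heis_fun.
Proof.
move=> k x y; rewrite /heis_fun !mxE !scalerDl !scalerDr !scalerA.
by rewrite [in RHS]addrACA; congr (_ + _); rewrite addrACA.
Qed.

HB.instance Definition _ :=
  GRing.isLinear.Build K heisenberg W *:%R heis_fun heis_fun_linear.

Definition heis_map : 'Hom(heisenberg, W) := linfun heis_fun.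

Lemma heis_mapE x : heis_map x = heis_fun x.
Proof. exact: lfunE. Qed.

Lemma heis_map1 : heis_map e1 = x1.
Proof.
by rewrite heis_mapE /heis_fun !mxE /= scale1r !scale0r !addr0.
Qed.

Lemma heis_map2 : heis_map e2 = x2.
Proof.
by rewrite heis_mapE /heis_fun !mxE /= scale1r !scale0r addr0 add0r.
Qed.

Lemma heis_map3 : heis_map e3 = x3.
Proof.
by rewrite heis_mapE /heis_fun !mxE /= scale1r !scale0r !add0r.
Qed.

End HeisMap.

Lemma heis_rep_lie (V : vectType K) (A B : 'End(V)) :
  (A \o B)%VF = (B \o A)%VF ->
  forall x y : heisenberg,
  heis_map A B 0 (lie x y)
  = (heis_map A B 0 x \o heis_map A B 0 y)%VF
    - (heis_map A B 0 y \o heis_map A B 0 x)%VF.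
Proof.
move=> AB x y; rewrite !heis_mapE /heis_fun /= /heis_lie !mxE /=.
rewrite !scaler0 !addr0 !mulr0 !scale0r addr0.
apply/esym/eqP; rewrite subr_eq0; apply/eqP.
rewrite !comp_lfunDl !comp_lfunDr -!comp_lfunZl -!comp_lfunZr !scalerA AB.
rewrite [in RHS]addrACA; congr (_ + _ + (_ + _));
  by rewrite mulrC.
Qed.

(* The representation with e1 |-> A, e2 |-> B, e3 |-> 0. *)
Definition heis_rep (V : vectType K) (A B : 'End(V))
    (AB : (A \o B)%VF = (B \o A)%VF) : representation heisenberg V :=
  Representation (heis_rep_lie AB).

End Heisenberg.

Arguments heis_rep {K V} A B AB.
Arguments e1 {K}.
Arguments e2 {K}.
Arguments e3 {K}.
Arguments H3' {K}.
Arguments H3 {K}.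
Arguments H4' {K}.
Arguments H4 {K}.
Arguments H5 {K}.
Arguments H6 {K}.
Arguments H8 {K}.
Arguments H9 {K}.

Section Operators.
Variables (K : fieldType) (V : vectType K) (v : 3.-tuple V).

Section Elementary.
Variables i j : 'I_3.

Definition E_fun (u : V) : V := coord v i u *: tnth v j.

Lemma E_fun_linear : linear E_fun.
Proof. by move=> k x y; rewrite /E_fun linearP scalerDl scalerA. Qed.

HB.instance Definition _ :=
  GRing.isLinear.Build K V V *:%R E_fun E_fun_linear.

(* The convention is v_i |-> v_j. *)
Definition E : 'End(V) := linfun E_fun.

End Elementary.

Definition diag (a b c : K) : 'End(V) :=
  a *: E i1 i1 + b *: E i2 i2 + c *: E i3 i3.

Hypothesis vP : basis_of fullv v.

Lemma E_tnth i j k : E i j (tnth v k) = if i == k then tnth v j else 0.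
Proof.
rewrite lfunE /= /E_fun (tnth_nth 0) (coord_free _ _ (basis_free vP)) eq_sym.
by case: eqP => _; rewrite ?scale1r ?scale0r.
Qed.

Lemma E_comp i j k l : (E i j \o E k l)%VF = if l == i then E k j else 0.
Proof.
apply/lfunP => u; rewrite comp_lfunE [E k l u]lfunE /= /E_fun linearZ /=.
rewrite E_tnth eq_sym; case: eqP => _; first by rewrite [RHS]lfunE.
by rewrite scaler0 zero_lfunE.
Qed.

Lemma diag_comp a b c a' b' c' :
  (diag a b c \o diag a' b' c')%VF = diag (a' * a) (b' * b) (c' * c).
Proof.
rewrite !comp_lfunDl !comp_lfunDr -!comp_lfunZl -!comp_lfunZr !E_comp /=.
by rewrite !scaler0 !addr0 !add0r !scalerA ![_ * a']mulrC ![_ * b']mulrC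
  ![_ * c']mulrC.
Qed.

Lemma diag_E21 a c : (diag a a c \o E i2 i1)%VF = (E i2 i1 \o diag a a c)%VF.
Proof.
rewrite !comp_lfunDl !comp_lfunDr -!comp_lfunZl -!comp_lfunZr !E_comp /=.
by rewrite !scaler0 !addr0 !add0r.
Qed.

Lemma scalar_comm a b (A B : 'End(V)) : (A \o B)%VF = (B \o A)%VF ->
  ((a *: \1 + A) \o (b *: \1 + B))%VF = ((b *: \1 + B) \o (a *: \1 + A))%VF.
Proof.
move=> AB; rewrite !comp_lfunDl !comp_lfunDr -!comp_lfunZl -!comp_lfunZr.
by rewrite !comp_lfun1l !comp_lfun1r !scalerA mulrC AB addrACA.
Qed.

End Operators.

Section Cases.
Variables (K : fieldType) (V : vectType K) (v : 3.-tuple V).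
Hypothesis vP : basis_of fullv v.

Local Notation E := (E v).
Local Notation diag := (diag v).
Local Notation I := (\1%VF : 'End(V)).

Lemma BI_comm a b c a' b' c' :
  (diag a b c \o diag a' b' c')%VF = (diag a' b' c' \o diag a b c)%VF.
Proof. by rewrite !(diag_comp vP) ![_ * a]mulrC ![_ * b]mulrC ![_ * c]mulrC. Qed.

Definition BI a b c a' b' c' : representation (heisenberg K) V :=
  heis_rep (diag a b c) (diag a' b' c') (BI_comm a b c a' b' c').

Lemma BII_comm a c a' c' :
  (diag a a c \o (diag a' a' c' + E i2 i1))%VF
  = ((diag a' a' c' + E i2 i1) \o diag a a c)%VF.
Proof. by rewrite comp_lfunDl comp_lfunDr BI_comm (diag_E21 vP). Qed.

Definition BII a c a' c' : representation (heisenberg K) V :=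
  heis_rep (diag a a c) (diag a' a' c' + E i2 i1) (BII_comm a c a' c').

Lemma BIII_comm a a' :
  ((a *: I) \o (a' *: I + E i2 i1 + E i3 i2))%VF
  = ((a' *: I + E i2 i1 + E i3 i2) \o (a *: I))%VF.
Proof using vP.
by rewrite -comp_lfunZl -comp_lfunZr comp_lfun1l comp_lfun1r.
Qed.

Definition BIII a a' : representation (heisenberg K) V :=
  heis_rep (a *: I) (a' *: I + E i2 i1 + E i3 i2) (BIII_comm a a').

Lemma BIV_comm a a' :
  ((a *: I + E i2 i1) \o (a' *: I + E i3 i1))%VF
  = ((a' *: I + E i3 i1) \o (a *: I + E i2 i1))%VF.
Proof. by apply: scalar_comm; rewrite !(E_comp vP). Qed.

Definition BIV a a' : representation (heisenberg K) V :=
  heis_rep (a *: I + E i2 i1) (a' *: I + E i3 i1) (BIV_comm a a').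

Lemma BV_comm a a' :
  ((a *: I + E i3 i2) \o (a' *: I + E i3 i1))%VF
  = ((a' *: I + E i3 i1) \o (a *: I + E i3 i2))%VF.
Proof. by apply: scalar_comm; rewrite !(E_comp vP). Qed.

Definition BV a a' : representation (heisenberg K) V :=
  heis_rep (a *: I + E i3 i2) (a' *: I + E i3 i1) (BV_comm a a').

Lemma BVI_comm a a' :
  ((a *: I + E i3 i1) \o (a' *: I + E i2 i1 + E i3 i2))%VF
  = ((a' *: I + E i2 i1 + E i3 i2) \o (a *: I + E i3 i1))%VF.
Proof.
rewrite -addrA; apply: scalar_comm.
by rewrite comp_lfunDl comp_lfunDr !(E_comp vP).
Qed.

Definition BVI a a' : representation (heisenberg K) V :=
  heis_rep (a *: I + E i3 i1) (a' *: I + E i2 i1 + E i3 i2) (BVI_comm a a').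

End Cases.

(* Main.v *)
Require Import Defs.
From mathcomp Require Import all_boot all_order all_algebra.
From mathcomp Require Import complex reals.
From mathcomp Require Import ring.

Set Implicit Arguments.
Unset Strict Implicit.
Unset Printing Implicit Defensive.

Import GRing.Theory.
Local Open Scope ring_scope.

(** Everything is reduced to computations in a three-dimensional algebra by one
    general fact ([cocycle_equivP]): two bijective 1-cocycles are equivalent
    exactly when the products [q^-1 (f x (q y))] that they induce are
    isomorphic.  Given such an isomorphism [T], the map between the
    representation spaces is forced to be [q2 T^-1 q1^-1], and [T] preserves
    the bracket because the bracket is the commutator of the product.

    For a representation of the Heisenberg algebra with [e3 |-> 0], [e1 |-> A],
    [e2 |-> B], a map [q] is a cocycle iff [q e3 = A (q e2) - B (q e1)] and [A],
    [B] both kill [q e3] ([heis_cocycleP]).  Writing this in coordinates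
    determines all bijective cocycles.  In case [BI], each coordinate [z] of
    [q e3] satisfies [z = s y - s' x] and [s z = s' z = 0], hence vanishes.  In
    case [BII] the same argument leaves only the first coordinate.  In cases
    [BII] to [BVI] the nonzero vector [q e3] is then a common null vector of two
    triangular operators, which forces the eigenvalues [a], [a'] to be zero.

    Existence of an equivalence to the normal form is then the choice of a new
    basis [E1, E2, [E1, E2]] of the Heisenberg algebra with the prescribed
    multiplication table ([heis_cocycle_equiv]); only four products have to be
    compared, since [e3] annihilates the algebra.  In case [BIV] the product is
    a nondegenerate, nonsymmetric bilinear form on the span of [e1, e2] with
    values in the line of [e3]: if some [E1] has [E1 E1 <> 0], then a suitable
    [E2] with [E2 E1 = 0] gives [H7], and otherwise the form is alternating and
    gives [H8].  Conversely, distinct parameters give nonequivalent cocycles,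
    because an isomorphism of the two tables is an automorphism of the
    Heisenberg algebra, which is explicit in coordinates
    ([lie_automorphism_heis]); for [H7] the determinant of the form relative to
    its skew part is an invariant, and for [H10] the ratio of [e1 e2] to
    [e2 e1] is.

    Apart from the final theorem the field is arbitrary, with [2 <> 0] where
    needed. *)

(** * Bijective linear maps *)

Section LinearBijections.
Variables (K : fieldType) (U V : vectType K) (h : 'Hom(U, V)).

Lemma bij_lfunK : bijective h -> cancel h (h^-1)%VF.
Proof.
by move=> /bij_inj h_inj; apply/lker0_lfunK/lker0P.
Qed.

Lemma bij_lfunVK : bijective h -> cancel (h^-1)%VF h.
Proof.
move=> [k _ hk] y; apply: limg_lfunVK.
by rewrite -(hk y) memv_img ?memvf.
Qed.

Lemma bij_lfunV : bijective h -> bijective (h^-1)%VF.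
Proof. by move=> hb; exists h; [exact: bij_lfunVK|exact: bij_lfunK]. Qed.

Lemma inj_dim_bij : \dim {:U} = \dim {:V} -> injective h -> bijective h.
Proof.
move=> dimE /lker0P h0; exists (h^-1)%VF; first exact: lker0_lfunK.
move=> y; apply: limg_lfunVK; suff -> : limg h = fullv by exact: memvf.
apply/eqP; rewrite eqEdim subvf -dimE limg_dim_eq ?leqnn //.
by rewrite (eqP h0) capv0.
Qed.

End LinearBijections.

Lemma comp_lfun_bij (K : fieldType) (U V W : vectType K)
    (g : 'Hom(V, W)) (h : 'Hom(U, V)) :
  bijective g -> bijective h -> bijective (g \o h)%VF.
Proof.
move=> gb hb; apply: (eq_bij (bij_comp gb hb)) => x.
by rewrite comp_lfunE.
Qed.

(** * Cocycles, equivalence and left-symmetric products *)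

Section CocycleProducts.
Variables (K : fieldType) (L : lieAlgebra K).

Section OneCocycle.
Variables (V : vectType K) (f : representation L V) (q : 'Hom(L, V)).
Hypothesis qP : bijective_cocycle f q.

Lemma cocycle_mulK x y : q (cocycle_mul f q x y) = f x (q y).
Proof. by rewrite /cocycle_mul bij_lfunVK //; case: qP. Qed.

(** The bracket is the commutator of the product induced by a cocycle. *)
Lemma lie_cocycle_mul x y :
  lie x y = cocycle_mul f q x y - cocycle_mul f q y x.
Proof.
apply: (bij_inj qP.2).
by rewrite linearB /= !cocycle_mulK; case: qP => -> _.
Qed.

Lemma cocycle_mul_left_symmetric : left_symmetric (cocycle_mul f q).
Proof.
split=> [y k x x'|x k y y'|x y z].
- by rewrite /cocycle_mul linearP /= add_lfunE scale_lfunE linearP.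
- by rewrite /cocycle_mul !linearP.
apply: (bij_inj qP.2); rewrite !linearB /= !cocycle_mulK.
have -> : cocycle_mul f q x y = lie x y + cocycle_mul f q y x.
  by rewrite lie_cocycle_mul subrK.
rewrite linearD /= add_lfunE rep_lie add_lfunE opp_lfunE !comp_lfunE.
by rewrite addrAC [X in X + _ = _]addrAC subrr add0r addrC.
Qed.

End OneCocycle.

Lemma rep_equiv_refl (V : vectType K) (f : representation L V) : rep_equiv f f.
Proof.
have idb (W : vectType K) : bijective (\1%VF : 'End(W)).
  by exists id => x; rewrite id_lfunE.
exists \1%VF, \1%VF; split=> // [|x].
  by split=> // x y; rewrite !id_lfunE.
have -> : (\1^-1)%VF = \1%VF :> 'End(V).
  by apply/lfunP=> u; rewrite -[LHS]id_lfunE bij_lfunVK ?id_lfunE.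
by rewrite comp_lfun1l comp_lfun1r id_lfunE.
Qed.

(** A bijective cocycle [q2] pulls back to [g^-1 q2 T^-1]. *)
Lemma rep_equiv_bijective_cocycle (V1 V2 : vectType K)
    (f1 : representation L V1) (f2 : representation L V2) q2 :
  rep_equiv f1 f2 -> bijective_cocycle f2 q2 ->
  exists q1, bijective_cocycle f1 q1.
Proof.
move=> [T [g [[Tb TL] gb fE]]] [q2c q2b].
exists (g^-1 \o q2 \o T^-1)%VF; split; last first.
  by do !apply: comp_lfun_bij => //; exact: bij_lfunV.
have q2f x y : (g^-1)%VF (f2 (T^-1 x)%VF (q2 y)) = f1 x ((g^-1)%VF (q2 y)).
  by rewrite fE !comp_lfunE /= bij_lfunVK // bij_lfunK.
move=> x y; rewrite !comp_lfunE /= -!q2f -linearB /= -q2c; congr (_ (q2 _)).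
by apply: (bij_inj Tb); rewrite TL !bij_lfunVK.
Qed.

Lemma cocycle_equivW (V1 V2 : vectType K)
    (f1 : representation L V1) q1 (f2 : representation L V2) q2 :
  cocycle_equiv f1 q1 f2 q2 -> rep_equiv f1 f2.
Proof. by move=> [T [g [TP gb fE _]]]; exists T, g. Qed.

Lemma lsa_isomorphism_lie (V1 V2 : vectType K)
    (f1 : representation L V1) q1 (f2 : representation L V2) q2 (T : 'End(L)) :
  bijective_cocycle f1 q1 -> bijective_cocycle f2 q2 ->
  (forall x y, T (cocycle_mul f2 q2 x y) = cocycle_mul f1 q1 (T x) (T y)) ->
  forall x y, T (lie x y) = lie (T x) (T y).
Proof.
move=> q1P q2P TM x y.
by rewrite (lie_cocycle_mul q2P) (lie_cocycle_mul q1P) linearB /= !TM.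
Qed.

(** Equivalence of bijective cocycles is isomorphism of the induced
    left-symmetric algebras. *)
Lemma cocycle_equivP (V1 V2 : vectType K)
    (f1 : representation L V1) q1 (f2 : representation L V2) q2 :
  bijective_cocycle f1 q1 -> bijective_cocycle f2 q2 ->
  cocycle_equiv f1 q1 f2 q2 <->
  lsa_isomorphic (cocycle_mul f2 q2) (cocycle_mul f1 q1).
Proof.
move=> q1P q2P; split=> [[T [g [[Tb _] gb fE qE]]]|[T Tb TM]].
  exists T => // x y.
  apply: (bij_inj q1P.2); apply: (bij_inj gb).
  have gq1T z : g (q1 (T z)) = q2 z by rewrite qE !comp_lfunE.
  rewrite gq1T !cocycle_mulK // -gq1T fE !comp_lfunE /=.
  by rewrite bij_lfunK.
(* The only map [g] that satisfies [q2 = g q1 T]. *)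
exists T, (q2 \o T^-1 \o q1^-1)%VF.
have gb : bijective (q2 \o T^-1 \o q1^-1)%VF.
  case: q1P q2P => _ q1b [_ q2b].
  by do !apply: comp_lfun_bij => //; exact: bij_lfunV.
have gE z : (q2 \o T^-1 \o q1^-1)%VF (q1 (T z)) = q2 z.
  by rewrite !comp_lfunE /= bij_lfunK ?bij_lfunK //; case: q1P.
split=> //.
- by split=> //; apply: lsa_isomorphism_lie TM.
- move=> x; apply/lfunP => u.
  have [y ->] : exists y, u = q2 y.
    by exists (q2^-1 u)%VF; rewrite bij_lfunVK //; case: q2P.
  rewrite 2!comp_lfunE -{2}gE bij_lfunK // -(cocycle_mulK q1P) -TM gE.
  by rewrite cocycle_mulK.
- by apply/lfunP => z; rewrite 2!comp_lfunE gE.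
Qed.

Lemma cocycle_classification1 (V : vectType K) (f : representation L V) q0 :
  bijective_cocycle f q0 ->
  (forall q, bijective_cocycle f q -> cocycle_equiv f q f q0) ->
  cocycle_classification f (fun q => q = q0).
Proof.
move=> q0P q0_equiv; split=> [q -> //|q qP|q q' -> -> //].
by exists q0 => //; exact: q0_equiv.
Qed.

End CocycleProducts.

(** * The Heisenberg algebra in coordinates *)

Section HeisenbergCoordinates.
Variable K : fieldType.
Local Notation H := (heisenberg K).

(** The vector of the Heisenberg algebra with coordinates [a], [b], [c]. *)
Definition hvec (a b c : K) : H := a *: e1 + b *: e2 + c *: e3.

Lemma hvec_eta (x : H) :
  x = hvec ((x : 'rV[K]_3) 0 i1) ((x : 'rV[K]_3) 0 i2) ((x : 'rV[K]_3) 0 i3).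
Proof.
apply/rowP => j; rewrite !mxE eqxx /=.
by case: j => -[|[|[|//]]] j3; rewrite !eqE /= ?mulr1 ?mulr0 ?addr0 ?add0r;
  congr (_ _ _); apply: val_inj.
Qed.

Lemma hvec_coord a b c :
  [/\ (hvec a b c : 'rV[K]_3) 0 i1 = a, (hvec a b c : 'rV[K]_3) 0 i2 = b
    & (hvec a b c : 'rV[K]_3) 0 i3 = c].
Proof. by split; rewrite !mxE /= ?mulr1 ?mulr0 ?addr0 ?add0r. Qed.

Lemma hvec_inj a b c a' b' c' :
  hvec a b c = hvec a' b' c' -> [/\ a = a', b = b' & c = c'].
Proof.
move=> E; have [] := hvec_coord a b c; rewrite E.
by have [-> -> ->] := hvec_coord a' b' c'; split.
Qed.

Lemma hvec_eq a b c a' b' c' :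
  a = a' -> b = b' -> c = c' -> hvec a b c = hvec a' b' c'.
Proof. by move=> -> -> ->. Qed.

Lemma hvecD a b c a' b' c' :
  hvec a b c + hvec a' b' c' = hvec (a + a') (b + b') (c + c').
Proof.
by rewrite /hvec !scalerDl [LHS]addrACA; congr (_ + _); apply: addrACA.
Qed.

Lemma hvecZ k a b c : k *: hvec a b c = hvec (k * a) (k * b) (k * c).
Proof. by rewrite /hvec !scalerDr !scalerA. Qed.

Lemma hvecN a b c : - hvec a b c = hvec (- a) (- b) (- c).
Proof. by rewrite -!scaleN1r hvecZ !mulN1r. Qed.

Lemma e1E : e1 = hvec 1 0 0.
Proof. by rewrite /hvec scale1r !scale0r !addr0. Qed.
Lemma e2E : e2 = hvec 0 1 0.
Proof. by rewrite /hvec scale1r !scale0r addr0 add0r. Qed.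
Lemma e3E : e3 = hvec 0 0 1.
Proof. by rewrite /hvec scale1r !scale0r !add0r. Qed.
Lemma hvec0 : 0 = hvec 0 0 0.
Proof. by rewrite /hvec !scale0r !add0r. Qed.

(** Rewrites every linear combination of basis vectors as a single [hvec]. *)
Definition hvecE := (e1E, e2E, e3E, hvec0, hvecZ, hvecN, hvecD).

Lemma heis_lie_hvec a b c a' b' c' :
  lie (hvec a b c) (hvec a' b' c') = hvec 0 0 (a * b' - b * a').
Proof.
rewrite /= /heis_lie -[delta_mx _ _]/(e3 : H).
have [-> -> _] := hvec_coord a b c; have [-> -> _] := hvec_coord a' b' c'.
by rewrite e3E hvecZ !mulr0 mulr1.
Qed.

Section MapsFromHeis.
Variable W : vectType K.

Lemma lfun_hvec (q : 'Hom(H, W)) a b c :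
  q (hvec a b c) = a *: q e1 + b *: q e2 + c *: q e3.
Proof. by rewrite !linearD !linearZ. Qed.

Lemma heis_map_hvec (w1 w2 w3 : W) a b c :
  heis_map w1 w2 w3 (hvec a b c) = a *: w1 + b *: w2 + c *: w3.
Proof. by rewrite lfun_hvec heis_map1 heis_map2 heis_map3. Qed.

Lemma heis_map_eta (q : 'Hom(H, W)) : q = heis_map (q e1) (q e2) (q e3).
Proof.
apply/lfunP => x; by rewrite (hvec_eta x) heis_map_hvec lfun_hvec.
Qed.

End MapsFromHeis.

(** The tables of interest vanish on products with [e3]. *)
Lemma table_mulE (t : nat -> nat -> H) (x y : H) :
  (forall i, t i 3%N = 0) -> (forall j, t 3%N j = 0) ->
  table_mul t x y =
    ((x : 'rV[K]_3) 0 i1 * (y : 'rV[K]_3) 0 i1) *: t 1%N 1%N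
    + ((x : 'rV[K]_3) 0 i1 * (y : 'rV[K]_3) 0 i2) *: t 1%N 2%N
    + (((x : 'rV[K]_3) 0 i2 * (y : 'rV[K]_3) 0 i1) *: t 2%N 1%N
    + ((x : 'rV[K]_3) 0 i2 * (y : 'rV[K]_3) 0 i2) *: t 2%N 2%N).
Proof.
move=> ti3 t3j; rewrite /table_mul !big_ord_recl !big_ord0 /=.
rewrite !ti3 !t3j !scaler0 !addr0.
have -> : ord0 = i1 :> 'I_3 by apply: val_inj.
by have -> : lift i1 ord0 = i2 :> 'I_3 by apply: val_inj.
Qed.

Lemma table_mul_hvec (t : nat -> nat -> H) a b c a' b' c' :
  (forall i, t i 3%N = 0) -> (forall j, t 3%N j = 0) ->
  table_mul t (hvec a b c) (hvec a' b' c') =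
    (a * a') *: t 1%N 1%N + (a * b') *: t 1%N 2%N
    + ((b * a') *: t 2%N 1%N + (b * b') *: t 2%N 2%N).
Proof.
move=> ti3 t3j; rewrite table_mulE //.
by have [-> -> _] := hvec_coord a b c; have [-> -> _] := hvec_coord a' b' c'.
Qed.

Section HeisRep.
Variables (V : vectType K) (A B : 'End(V)) (AB : (A \o B)%VF = (B \o A)%VF).
Local Notation f := (heis_rep A B AB).

Lemma heis_rep_hvec a b c u : f (hvec a b c) u = a *: A u + b *: B u.
Proof.
by rewrite /= heis_map_hvec scaler0 addr0 !add_lfunE !scale_lfunE.
Qed.

Lemma heis_cocycleP q :
  cocycle f q <->
  [/\ q e3 = A (q e2) - B (q e1), A (q e3) = 0 & B (q e3) = 0].
Proof.
split=> [qP|[q3 Aq3 Bq3] x y].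
  have q3 := qP e1 e2; have q13 := qP e1 e3; have q23 := qP e2 e3.
  move: q3 q13 q23; rewrite heis_lie12 [X in _ = X -> _]/=.
  rewrite e1E e2E e3E !heis_lie_hvec !heis_rep_hvec.
  rewrite !(mulr0, mul0r, mulr1, subrr, scale0r, scale1r, addr0, add0r, oppr0).
  by rewrite -hvec0 linear0 => q3 <- <-.
rewrite (hvec_eta x) (hvec_eta y).
move: (_ 0 i1) (_ 0 i2) (_ 0 i3) => a b c.
move: (_ 0 i1) (_ 0 i2) (_ 0 i3) => a' b' c'.
rewrite heis_lie_hvec !heis_rep_hvec !lfun_hvec scale0r scale0r !add0r.
rewrite !linearD !linearZ /= Aq3 Bq3 !scaler0 !addr0 q3.
rewrite !scalerDr !scalerA !scalerN !(scaler0, oppr0, addr0).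
rewrite [RHS]addrACA [X in _ = X + _]addrACA [X in _ = _ + X]addrACA.
rewrite [a' * a]mulrC [b' * b]mulrC !subrr add0r addr0.
rewrite -!scalerBl -scaleNr opprB.
by rewrite [b' * a]mulrC [a' * b]mulrC.
Qed.

Section GivenCocycle.
Variable q : 'Hom(H, V).
Hypothesis qP : bijective_cocycle f q.

Lemma heis_cocycle_hvec a b c a' b' c' :
  f (hvec a b c) (q (hvec a' b' c')) =
    (a * a') *: A (q e1) + (a * b') *: A (q e2)
    + ((b * a') *: B (q e1) + (b * b') *: B (q e2)).
Proof.
have [/heis_cocycleP [_ Aq3 Bq3] _] := qP.
rewrite heis_rep_hvec lfun_hvec !linearD !linearZ /= Aq3 Bq3 !scaler0 !addr0.
by rewrite ?scalerDr !scalerA ![a' * _]mulrC ![b' * _]mulrC.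
Qed.

(** To identify the product of a cocycle with a table, it suffices to compare
    the products of [e1] and [e2]. *)
Lemma heis_gives_lsa (t : nat -> nat -> H) :
  (forall i, t i 3%N = 0) -> (forall j, t 3%N j = 0) ->
  A (q e1) = q (t 1%N 1%N) -> A (q e2) = q (t 1%N 2%N) ->
  B (q e1) = q (t 2%N 1%N) -> B (q e2) = q (t 2%N 2%N) ->
  gives_lsa f q (table_mul t).
Proof.
move=> ti3 t3j t11 t12 t21 t22.
have mulE x y : cocycle_mul f q x y = table_mul t x y.
  apply: (bij_inj qP.2); rewrite (cocycle_mulK qP) (hvec_eta x) (hvec_eta y).
  rewrite heis_cocycle_hvec table_mul_hvec // !linearD !linearZ.
  by rewrite t11 t12 t21 t22.
split=> //; have [mull mulr mulA] := cocycle_mul_left_symmetric qP.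
split=> [y k x x'|x k y y'|x y z]; rewrite -!mulE; [exact: mull|exact: mulr|].
exact: mulA.
Qed.

(** If [E1] and [E2], with coordinates [(a, b, c)] and [(a', b', c')], are
    independent modulo [e3] and multiply in the algebra of [q] as [e1] and [e2]
    do in the algebra of [q'], then the two cocycles are equivalent. *)
Lemma heis_cocycle_equiv (W : vectType K) (f' : representation H W)
    (q' : 'Hom(H, W)) (t : nat -> nat -> H) (a b c a' b' c' : K) :
  bijective_cocycle f' q' -> gives_lsa f' q' (table_mul t) ->
  (forall i, t i 3%N = 0) -> (forall j, t 3%N j = 0) ->
  a * b' - b * a' != 0 ->
  let E1 := hvec a b c in let E2 := hvec a' b' c' in
  let T := heis_map E1 E2 (hvec 0 0 (a * b' - b * a')) in
  f E1 (q E1) = q (T (t 1%N 1%N)) -> f E1 (q E2) = q (T (t 1%N 2%N)) ->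
  f E2 (q E1) = q (T (t 2%N 1%N)) -> f E2 (q E2) = q (T (t 2%N 2%N)) ->
  cocycle_equiv f q f' q'.
Proof.
move=> q'P [_ tE] ti3 t3j d0 E1 E2 T t11 t12 t21 t22.
apply/(cocycle_equivP qP q'P).
have TE x y z : T (hvec x y z) = hvec (x * a + y * a') (x * b + y * b')
    (x * c + y * c' + z * (a * b' - b * a')).
  by rewrite /T heis_map_hvec !hvecE !mulr0 !addr0.
exists T.
  apply: inj_dim_bij => // x y Txy; apply/subr0_eq.
  have {Txy} : T (x - y) = 0 by rewrite linearB /= Txy subrr.
  rewrite [x - y]hvec_eta TE hvec0 => /hvec_inj [].
  move: (_ 0 i1) (_ 0 i2) (_ 0 i3) => u v w Ea Eb Ec.
  have u0 : u = 0.
    apply/(mulIf d0).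
    transitivity (b' * (u * a + v * a') - a' * (u * b + v * b'));
      first by ring.
    by rewrite Ea Eb; ring.
  have v0 : v = 0.
    apply/(mulIf d0).
    transitivity (a * (u * b + v * b') - b * (u * a + v * a'));
      first by ring.
    by rewrite Ea Eb; ring.
  move: Ec; rewrite u0 v0 !mul0r !add0r => /eqP.
  by rewrite mulf_eq0 (negPf d0) orbF => /eqP ->.
have [/heis_cocycleP [_ Aq3 Bq3] _] := qP.
have fq3 x : f x (q e3) = 0.
  by rewrite [x]hvec_eta heis_rep_hvec Aq3 Bq3 !scaler0 addr0.
have f3 u : f e3 u = 0 by rewrite e3E heis_rep_hvec !scale0r addr0.
clearbody E1 E2; have {}TE x y z :
  T (hvec x y z) = x *: E1 + y *: E2 + (z * (a * b' - b * a')) *: e3.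
  by rewrite /T heis_map_hvec /hvec !scale0r !add0r scalerA.
have fT x y z u : f (T (hvec x y z)) u = x *: f E1 u + y *: f E2 u.
  rewrite TE !linearD !linearZ /= !add_lfunE !scale_lfunE.
  by rewrite [X in _ + _ *: X]f3 scaler0 addr0.
have qT x y z w : f x (q (T (hvec y z w))) = y *: f x (q E1) + z *: f x (q E2).
  by rewrite TE !linearD !linearZ /= fq3 scaler0 addr0.
move=> x y; apply: (bij_inj qP.2); rewrite tE (cocycle_mulK qP).
rewrite (hvec_eta x) (hvec_eta y) fT !qT table_mul_hvec //.
by rewrite t11 t12 t21 t22 !scalerDr !scalerA !linearD !linearZ.
Qed.

End GivenCocycle.

End HeisRep.

End HeisenbergCoordinates.

Section HeisenbergAutomorphisms.
Variable K : fieldType.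
Local Notation H := (heisenberg K).

(** An automorphism is determined by the images of [e1] and [e2], which are
    independent modulo [e3]. *)
Lemma lie_automorphism_heis (T : 'End(H)) : lie_automorphism T ->
  exists a b c a' b' c',
    [/\ T = heis_map (hvec a b c) (hvec a' b' c') (hvec 0 0 (a * b' - b * a'))
      & a * b' - b * a' != 0].
Proof.
move=> [Tb Tlie]; have := heis_map_eta T.
have e12 : T e3 = lie (T e1) (T e2) by rewrite -Tlie heis_lie12.
rewrite (hvec_eta (T e1)) (hvec_eta (T e2)) in e12 *.
move: e12; move: (_ 0 i1) (_ 0 i2) (_ 0 i3) => a b c.
move: (_ 0 i1) (_ 0 i2) (_ 0 i3) => a' b' c'.
rewrite heis_lie_hvec => e12; rewrite e12 => TE.
exists a, b, c, a', b', c'; split=> //; apply/eqP => d0.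
have /(bij_inj Tb) : T e3 = T 0 by rewrite e12 d0 -hvec0 linear0.
rewrite e3E hvec0 => /hvec_inj [_ _ /eqP]; by rewrite oner_eq0.
Qed.

(** An equivalence of cocycles, read on the tables of their products. *)
Lemma table_equiv (V W : vectType K) (f : representation H V) (q : 'Hom(H, V))
    (f' : representation H W) (q' : 'Hom(H, W)) mul mul' :
  bijective_cocycle f q -> bijective_cocycle f' q' ->
  gives_lsa f q mul -> gives_lsa f' q' mul' -> cocycle_equiv f q f' q' ->
  exists a b c a' b' c',
    let T := heis_map (hvec a b c) (hvec a' b' c')
               (hvec 0 0 (a * b' - b * a')) : 'End(H) in
    a * b' - b * a' != 0 /\ forall x y, T (mul' x y) = mul (T x) (T y).
Proof.
move=> qP q'P [_ mulE] [_ mul'E] /(cocycle_equivP qP q'P) [T Tb TM].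
have TA : lie_automorphism T.
  by split=> //; apply: lsa_isomorphism_lie qP q'P TM.
have [a [b [c [a' [b' [c' [TE d0]]]]]]] := lie_automorphism_heis TA.
exists a, b, c, a', b', c'; rewrite -TE; split=> // x y.
by rewrite -mulE -mul'E TM.
Qed.

End HeisenbergAutomorphisms.

(** * Isomorphisms between the tables *)

Section TableIsomorphisms.
Variable K : fieldType.
Local Notation H := (heisenberg K).

Lemma H3'_isomorphic_H3 : lsa_isomorphic (@H3' K) (@H3 K).
Proof.
exists (heis_map (e1 - e2) e2 e3).
  exists (heis_map (e1 + e2) e2 e3) => x; rewrite (hvec_eta x) !heis_map_hvec;
    rewrite !hvecE !heis_map_hvec !hvecE; apply: hvec_eq; ring.
move=> x y; rewrite (hvec_eta x) (hvec_eta y).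
move: (_ 0 i1) (_ 0 i2) (_ 0 i3) => a b c.
move: (_ 0 i1) (_ 0 i2) (_ 0 i3) => a' b' c'.
rewrite /H3' /H3 !heis_map_hvec !hvecE !table_mul_hvec;
  do ?by rewrite ?hvec0; case=> [|[|[]]].
by rewrite !hvecE !heis_map_hvec !hvecE; apply: hvec_eq; ring.
Qed.

Lemma H4'_isomorphic_H4 : lsa_isomorphic (@H4' K) (@H4 K).
Proof.
exists (heis_map (- e2) e1 e3).
  exists (heis_map e2 (- e1) e3) => x; rewrite (hvec_eta x) !heis_map_hvec;
    rewrite !hvecE !heis_map_hvec !hvecE; apply: hvec_eq; ring.
move=> x y; rewrite (hvec_eta x) (hvec_eta y).
move: (_ 0 i1) (_ 0 i2) (_ 0 i3) => a b c.
move: (_ 0 i1) (_ 0 i2) (_ 0 i3) => a' b' c'.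
rewrite /H4' /H4 !heis_map_hvec !hvecE !table_mul_hvec;
  do ?by rewrite ?hvec0; case=> [|[|[]]].
by rewrite !hvecE !heis_map_hvec !hvecE; apply: hvec_eq; ring.
Qed.

End TableIsomorphisms.

(** * Cocycles on a three-dimensional space, in coordinates *)

(** The determinant of the matrix with rows [x], [y] and [z]. *)
Definition det3 (K : fieldType) (x1 x2 x3 y1 y2 y3 z1 z2 z3 : K) : K :=
  x1 * (y2 * z3 - y3 * z2) - x2 * (y1 * z3 - y3 * z1)
  + x3 * (y1 * z2 - y2 * z1).

Section VectorCoordinates.
Variables (K : fieldType) (V : vectType K) (v1 v2 v3 : V).

(** The vector of [V] with coordinates [a], [b], [c]. *)
Definition vec (a b c : K) : V := a *: v1 + b *: v2 + c *: v3.

Lemma vecD a b c a' b' c' :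
  vec a b c + vec a' b' c' = vec (a + a') (b + b') (c + c').
Proof.
by rewrite /vec !scalerDl [LHS]addrACA; congr (_ + _); apply: addrACA.
Qed.

Lemma vecZ k a b c : k *: vec a b c = vec (k * a) (k * b) (k * c).
Proof. by rewrite /vec !scalerDr !scalerA. Qed.

Lemma vecN a b c : - vec a b c = vec (- a) (- b) (- c).
Proof. by rewrite -!scaleN1r vecZ !mulN1r. Qed.

Lemma vec0 : 0 = vec 0 0 0.
Proof. by rewrite /vec !scale0r !add0r. Qed.

Hypothesis vP : basis_of fullv [tuple v1; v2; v3].
Local Notation v := [tuple v1; v2; v3].

Lemma vec_coord a b c :
  [/\ coord v i1 (vec a b c) = a, coord v i2 (vec a b c) = b
    & coord v i3 (vec a b c) = c].
Proof.
have cv i j : coord v i (tnth v j) = (i == j)%:R.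
  by rewrite (tnth_nth 0) (coord_free _ _ (basis_free vP)) eq_sym.
have cE i : coord v i (vec a b c)
    = a * (i == i1)%:R + b * (i == i2)%:R + c * (i == i3)%:R.
  by rewrite !linearD !linearZ /= -!cv.
by split; rewrite cE ?mulr1 ?mulr0 ?addr0 ?add0r.
Qed.

Lemma vec_inj a b c a' b' c' :
  vec a b c = vec a' b' c' -> [/\ a = a', b = b' & c = c'].
Proof.
move=> E; have [] := vec_coord a b c; rewrite E.
by have [-> -> ->] := vec_coord a' b' c'; split.
Qed.

Lemma vec_eq a b c a' b' c' :
  a = a' -> b = b' -> c = c' -> vec a b c = vec a' b' c'.
Proof. by move=> -> -> ->. Qed.

Lemma vec_eq0 a b c : a = 0 -> b = 0 -> c = 0 -> vec a b c = 0.
Proof. by rewrite vec0 => -> -> ->. Qed.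

Lemma vec_eta u : u = vec (coord v i1 u) (coord v i2 u) (coord v i3 u).
Proof.
rewrite [LHS](coord_basis vP (memvf u)) !big_ord_recl big_ord0 addr0 addrA.
have -> : ord0 = i1 :> 'I_3 by apply: val_inj.
have -> : lift i1 ord0 = i2 :> 'I_3 by apply: val_inj.
by have -> : lift i1 (lift ord0 ord0) = i3 :> 'I_3 by apply: val_inj.
Qed.

Lemma E21_vec a b c : E v i2 i1 (vec a b c) = vec b 0 0.
Proof.
rewrite lfunE /= /E_fun; have [_ -> _] := vec_coord a b c.
by rewrite [in RHS]/vec !scale0r !addr0.
Qed.

Lemma E31_vec a b c : E v i3 i1 (vec a b c) = vec c 0 0.
Proof.
rewrite lfunE /= /E_fun; have [_ _ ->] := vec_coord a b c.
by rewrite [in RHS]/vec !scale0r !addr0.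
Qed.

Lemma E32_vec a b c : E v i3 i2 (vec a b c) = vec 0 c 0.
Proof.
rewrite lfunE /= /E_fun; have [_ _ ->] := vec_coord a b c.
by rewrite [in RHS]/vec !scale0r addr0 add0r.
Qed.

Lemma diag_vec a b c x y z :
  diag v a b c (vec x y z) = vec (a * x) (b * y) (c * z).
Proof.
rewrite !add_lfunE !scale_lfunE !lfunE /= /E_fun.
by have [-> -> ->] := vec_coord x y z; rewrite !scalerA.
Qed.

(** Rewrite rules that evaluate linear combinations of vectors, then operators,
    on coordinates.  The sums come first so that operators meet a [vec]. *)
Definition vec_sumE := (vecZ, vecN, vecD).

Definition vecE := (vec_sumE, diag_vec, E21_vec, E31_vec, E32_vec,
  id_lfunE, scale_lfunE, add_lfunE).

Local Notation H := (heisenberg K).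

Lemma dim_heis : \dim {:H} = \dim {:V}.
Proof. by rewrite (size_basis vP) dimvf. Qed.

Lemma heis_map_bijP x1 x2 x3 y1 y2 y3 z1 z2 z3 :
  bijective (heis_map (vec x1 x2 x3) (vec y1 y2 y3) (vec z1 z2 z3)) <->
  det3 x1 x2 x3 y1 y2 y3 z1 z2 z3 != 0.
Proof.
set q := heis_map _ _ _.
have qE a b c : q (hvec a b c) = vec (a * x1 + b * y1 + c * z1)
    (a * x2 + b * y2 + c * z2) (a * x3 + b * y3 + c * z3).
  by rewrite heis_map_hvec !vecE.
split=> [qb|d0].
  have inv u : exists a b c, q (hvec a b c) = u.
    have := bij_lfunVK qb u; rewrite [(q^-1 u)%VF]hvec_eta.
    by move: (_ 0 i1) (_ 0 i2) (_ 0 i3) => a b c <-; exists a, b, c.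
  have [a [a' [a'']]] := inv (vec 1 0 0); rewrite qE => /vec_inj [a1 a2 a3].
  have [b [b' [b'']]] := inv (vec 0 1 0); rewrite qE => /vec_inj [b1 b2 b3].
  have [c [c' [c'']]] := inv (vec 0 0 1); rewrite qE => /vec_inj [c1 c2 c3].
  (* The matrix of [q] times the matrix of its inverse is the identity. *)
  apply/negP => /eqP d0; have : (1 : K) != 0 by exact: oner_neq0.
  suff -> : 1 = det3 a a' a'' b b' b'' c c' c''
                 * det3 x1 x2 x3 y1 y2 y3 z1 z2 z3 by rewrite d0 mulr0 eqxx.
  transitivity (det3
    (a * x1 + a' * y1 + a'' * z1) (a * x2 + a' * y2 + a'' * z2)
    (a * x3 + a' * y3 + a'' * z3) (b * x1 + b' * y1 + b'' * z1)
    (b * x2 + b' * y2 + b'' * z2) (b * x3 + b' * y3 + b'' * z3)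
    (c * x1 + c' * y1 + c'' * z1) (c * x2 + c' * y2 + c'' * z2)
    (c * x3 + c' * y3 + c'' * z3)); last by rewrite /det3; ring.
  by rewrite a1 a2 a3 b1 b2 b3 c1 c2 c3 /det3; ring.
apply: inj_dim_bij dim_heis _ => x y qxy; apply/subr0_eq.
have {qxy} : q (x - y) = 0 by rewrite linearB /= qxy subrr.
rewrite [x - y]hvec_eta; move: (_ 0 i1) (_ 0 i2) (_ 0 i3) => a b c.
rewrite qE vec0 => /vec_inj [E1 E2 E3].
have det0 w : det3 x1 x2 x3 y1 y2 y3 z1 z2 z3 * w = 0 -> w = 0.
  by move/eqP; rewrite mulf_eq0 (negPf d0) => /eqP.
(* Cramer's rule. *)
rewrite hvec0; congr hvec; apply: det0.
- transitivity (det3 (a * x1 + b * y1 + c * z1) (a * x2 + b * y2 + c * z2)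
    (a * x3 + b * y3 + c * z3) y1 y2 y3 z1 z2 z3); first by rewrite /det3; ring.
  by rewrite E1 E2 E3 /det3; ring.
- transitivity (det3 x1 x2 x3 (a * x1 + b * y1 + c * z1)
    (a * x2 + b * y2 + c * z2) (a * x3 + b * y3 + c * z3) z1 z2 z3);
    first by rewrite /det3; ring.
  by rewrite E1 E2 E3 /det3; ring.
- transitivity (det3 x1 x2 x3 y1 y2 y3 (a * x1 + b * y1 + c * z1)
    (a * x2 + b * y2 + c * z2) (a * x3 + b * y3 + c * z3));
    first by rewrite /det3; ring.
  by rewrite E1 E2 E3 /det3; ring.
Qed.

Lemma heis_bijective_cocycleP (A B : 'End(V)) AB x1 x2 x3 y1 y2 y3 z1 z2 z3 :
  let X := vec x1 x2 x3 in let Y := vec y1 y2 y3 in let Z := vec z1 z2 z3 in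
  bijective_cocycle (heis_rep A B AB) (heis_map X Y Z) <->
  [/\ Z = A Y - B X, A Z = 0, B Z = 0
    & det3 x1 x2 x3 y1 y2 y3 z1 z2 z3 != 0].
Proof.
move=> X Y Z; split=> [[/heis_cocycleP [] ]|[ZE AZ BZ d0]].
  by rewrite heis_map1 heis_map2 heis_map3 => ? ? ? /heis_map_bijP.
by split; [apply/heis_cocycleP; rewrite heis_map1 heis_map2 heis_map3|
  apply/heis_map_bijP].
Qed.

Lemma heis_map_coord (q : 'Hom(H, V)) :
  exists x1 x2 x3 y1 y2 y3 z1 z2 z3,
    q = heis_map (vec x1 x2 x3) (vec y1 y2 y3) (vec z1 z2 z3).
Proof.
rewrite (heis_map_eta q) (vec_eta (q e1)) (vec_eta (q e2)) (vec_eta (q e3)).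
by do 9!eexists.
Qed.

End VectorCoordinates.

(** Reduces an equality of vectors, built from coordinate vectors by operators
    and a linear map on the Heisenberg algebra, to three scalar equalities. *)
Ltac vec_calc :=
  match goal with vP : is_true (basis_of fullv _) |- _ =>
    rewrite ?heis_rep_hvec ?heis_map_hvec; cbv beta iota;
    rewrite ?hvecE ?heis_map_hvec ?hvecE ?heis_map_hvec ?vec_sumE ?(vecE vP)
  end; (apply: vec_eq || apply: vec_eq0).

(** Reduces the claim that an explicit map is a bijective cocycle to [d != 0],
    where [d] is the determinant of the map. *)
Ltac cocycle_calc d :=
  match goal with vP : is_true (basis_of fullv _) |- _ =>
    apply/(heis_bijective_cocycleP vP)
  end; split; try (by vec_calc; field);
  rewrite (_ : det3 _ _ _ _ _ _ _ _ _ = d); last by rewrite /det3; ring.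

(** Leaves the four products of [e1] and [e2]. *)
Ltac lsa_calc qP :=
  apply: (heis_gives_lsa qP) => [[|[|[]]]//|[|[|[]]]//||||].

Ltac vec_simp := rewrite /vec !(scale0r, scale1r, scaleN1r, add0r, addr0).

Section Scalars.
Variable K : fieldType.
Implicit Types (s x y z : K).

(** The hypotheses hold for a coordinate [z] of [q e3] on which the two operators
    act diagonally, by [s] and [s']; [x] and [y] are the same coordinate of
    [q e1] and [q e2]. *)
Lemma diff_eigen_eq0 s s' x y z :
  z = s * y - s' * x -> s * z = 0 -> s' * z = 0 -> z = 0.
Proof.
move=> zE sz s'z; suff /eqP : z * z = 0 by rewrite mulf_eq0 orbb => /eqP.
by rewrite {1}zE mulrBl mulrAC sz mulrAC s'z !mul0r subrr.
Qed.

Lemma det3_row0 x1 x2 x3 y1 y2 y3 : det3 x1 x2 x3 y1 y2 y3 0 0 0 = 0.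
Proof. by rewrite /det3; ring. Qed.

(** If a triangular operator with single eigenvalue [s] kills the last row of an
    invertible matrix, then [s] vanishes.  The hypotheses are the coordinates of
    this null vector equation, from the third to the first, each simplified by
    the previous ones. *)
Lemma triangular_eigen_eq0 s x1 x2 x3 y1 y2 y3 z1 z2 z3 :
  det3 x1 x2 x3 y1 y2 y3 z1 z2 z3 != 0 -> s * z3 = 0 ->
  (z3 = 0 -> s * z2 = 0) -> (z2 = 0 -> z3 = 0 -> s * z1 = 0) -> s = 0.
Proof.
move=> d0 sz3 sz2 sz1; apply/eqP/negPn/negP => s0; case/negP: d0.
have s_eq0 z : s * z = 0 -> z = 0.
  by move/eqP; rewrite mulf_eq0 (negPf s0) => /eqP.
have z30 := s_eq0 _ sz3; have z20 := s_eq0 _ (sz2 z30).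
by rewrite (s_eq0 _ (sz1 z20 z30)) z20 z30 det3_row0.
Qed.

End Scalars.

(** * Bijective cocycles in the six cases *)

Section Classification.
Variables (K : fieldType) (V : vectType K) (v1 v2 v3 : V).
Hypothesis vP : basis_of fullv [tuple v1; v2; v3].
Local Notation vec := (vec v1 v2 v3).

Lemma BI_no_bijective_cocycle a b c a' b' c' q :
  ~ bijective_cocycle (BI vP a b c a' b' c') q.
Proof.
have [x1 [x2 [x3 [y1 [y2 [y3 [z1 [z2 [z3 ->]]]]]]]]] := heis_map_coord vP q.
move=> /(heis_bijective_cocycleP vP) [].
rewrite !(vecE vP) !(@vec0 _ _ v1 v2 v3) => /(vec_inj vP) [E1 E2 E3].
move=> /(vec_inj vP) [A1 A2 A3] /(vec_inj vP) [B1 B2 B3].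
rewrite (diff_eigen_eq0 E1 A1 B1) (diff_eigen_eq0 E2 A2 B2).
by rewrite (diff_eigen_eq0 E3 A3 B3) det3_row0 eqxx.
Qed.

Lemma BII_coord a c a' c' x1 x2 x3 y1 y2 y3 z1 z2 z3 :
  bijective_cocycle (BII vP a c a' c')
    (heis_map (vec x1 x2 x3) (vec y1 y2 y3) (vec z1 z2 z3)) ->
  [/\ a = 0 /\ a' = 0, [/\ z1 = - x2, z2 = 0 & z3 = 0], c * y3 = c' * x3,
      x2 != 0 & x2 * y3 - x3 * y2 != 0].
Proof.
move=> /(heis_bijective_cocycleP vP) [].
rewrite !(vecE vP) !(@vec0 _ _ v1 v2 v3) => /(vec_inj vP) [E1 E2 E3].
move=> /(vec_inj vP) [A1 A2 A3] /(vec_inj vP) [B1 B2 B3] d0.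
rewrite !addr0 in E2 E3 B2 B3.
have z20 := diff_eigen_eq0 E2 A2 B2; have z30 := diff_eigen_eq0 E3 A3 B3.
rewrite z20 addr0 in B1; rewrite z30 in E3.
have dE : det3 x1 x2 x3 y1 y2 y3 z1 z2 z3 = (x2 * y3 - x3 * y2) * z1.
  by rewrite z20 z30 /det3; ring.
move: (d0); rewrite dE mulf_eq0 negb_or => /andP [xy z10].
have z1_eq0 s : s * z1 = 0 -> s = 0.
  by move/eqP; rewrite mulf_eq0 (negPf z10) orbF => /eqP.
have a0 := z1_eq0 _ A1; have a'0 := z1_eq0 _ B1.
have z1E : z1 = - x2 by rewrite E1 a0 a'0; ring.
split=> //; first by apply/subr0_eq/esym.
by rewrite -oppr_eq0 -z1E.
Qed.

Lemma BIII_coord a a' x1 x2 x3 y1 y2 y3 z1 z2 z3 :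
  bijective_cocycle (BIII vP a a')
    (heis_map (vec x1 x2 x3) (vec y1 y2 y3) (vec z1 z2 z3)) ->
  [/\ a = 0 /\ a' = 0, [/\ z1 = - x2, z2 = 0 & z3 = 0], x3 = 0,
      x2 != 0 & y3 != 0].
Proof.
move=> /(heis_bijective_cocycleP vP) [].
rewrite !(vecE vP) !(@vec0 _ _ v1 v2 v3) => /(vec_inj vP) [E1 E2 E3].
move=> /(vec_inj vP) [A1 A2 A3] /(vec_inj vP) [B1 B2 B3] d0.
rewrite !addr0 in B1 B2 B3.
have a0 : a = 0 by apply: (triangular_eigen_eq0 d0).
have a'0 : a' = 0.
  apply: (triangular_eigen_eq0 d0) => // [z30|z20 _].
    by rewrite z30 addr0 in B2.
  by rewrite z20 addr0 in B1.
rewrite a0 a'0 !(mul0r, add0r, addr0, sub0r, oppr0) in E1 E2 E3 B1 B2.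
have x30 : x3 = 0 by apply: oppr_inj; rewrite -E2 B1 oppr0.
have : det3 x1 x2 x3 y1 y2 y3 z1 z2 z3 = - (x2 * y3 * x2).
  by rewrite E1 B1 E3 x30 /det3; ring.
move=> dE; move: d0; rewrite dE oppr_eq0 !mulf_eq0 !negb_or.
by case/andP => /andP [].
Qed.

Lemma BIV_coord a a' x1 x2 x3 y1 y2 y3 z1 z2 z3 :
  bijective_cocycle (BIV vP a a')
    (heis_map (vec x1 x2 x3) (vec y1 y2 y3) (vec z1 z2 z3)) ->
  [/\ a = 0 /\ a' = 0, [/\ z1 = y2 - x3, z2 = 0 & z3 = 0],
      y2 - x3 != 0 & x2 * y3 - x3 * y2 != 0].
Proof.
move=> /(heis_bijective_cocycleP vP) [].
rewrite !(vecE vP) !(@vec0 _ _ v1 v2 v3) => /(vec_inj vP) [E1 E2 E3].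
move=> /(vec_inj vP) [A1 A2 A3] /(vec_inj vP) [B1 B2 B3] d0.
rewrite !addr0 in A2 A3 B2 B3.
have a0 : a = 0.
  by apply: (triangular_eigen_eq0 d0) => // z20 _; rewrite z20 addr0 in A1.
have a'0 : a' = 0.
  by apply: (triangular_eigen_eq0 d0) => // _ z30; rewrite z30 addr0 in B1.
rewrite a0 a'0 !(mul0r, add0r, addr0, oppr0) in E1 E2 E3.
have dE : det3 x1 x2 x3 y1 y2 y3 z1 z2 z3 = (x2 * y3 - x3 * y2) * (y2 - x3).
  by rewrite E1 E2 E3 /det3; ring.
by move: d0; rewrite dE mulf_eq0 negb_or => /andP [? ?]; split.
Qed.

Lemma BV_coord a a' x1 x2 x3 y1 y2 y3 z1 z2 z3 :
  bijective_cocycle (BV vP a a')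
    (heis_map (vec x1 x2 x3) (vec y1 y2 y3) (vec z1 z2 z3)) ->
  [/\ a = 0 /\ a' = 0, [/\ z1 = - x3, z2 = y3 & z3 = 0]
    & (x1 * y3 - x3 * y1) * y3 + (x2 * y3 - x3 * y2) * x3 != 0].
Proof.
move=> /(heis_bijective_cocycleP vP) [].
rewrite !(vecE vP) !(@vec0 _ _ v1 v2 v3) => /(vec_inj vP) [E1 E2 E3].
move=> /(vec_inj vP) [A1 A2 A3] /(vec_inj vP) [B1 B2 B3] d0.
rewrite !addr0 in A1 A3 B2 B3.
have a0 : a = 0.
  by apply: (triangular_eigen_eq0 d0) => // z30; rewrite z30 addr0 in A2.
have a'0 : a' = 0.
  by apply: (triangular_eigen_eq0 d0) => // _ z30; rewrite z30 addr0 in B1.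
rewrite a0 a'0 !(mul0r, add0r, addr0, sub0r, oppr0) in E1 E2 E3.
split=> //; rewrite -oppr_eq0; apply: contraNneq d0 => e0; apply/eqP.
by rewrite -e0 E1 E2 E3 /det3; ring.
Qed.

Lemma BVI_coord a a' x1 x2 x3 y1 y2 y3 z1 z2 z3 :
  bijective_cocycle (BVI vP a a')
    (heis_map (vec x1 x2 x3) (vec y1 y2 y3) (vec z1 z2 z3)) ->
  [/\ a = 0 /\ a' = 0, [/\ z1 = y3 - x2, z2 = 0 & z3 = 0], x3 = 0,
      x2 != 0 /\ y3 != 0 & y3 - x2 != 0].
Proof.
move=> /(heis_bijective_cocycleP vP) [].
rewrite !(vecE vP) !(@vec0 _ _ v1 v2 v3) => /(vec_inj vP) [E1 E2 E3].
move=> /(vec_inj vP) [A1 A2 A3] /(vec_inj vP) [B1 B2 B3] d0.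
rewrite !addr0 in A2 A3 B1 B2 B3.
have a0 : a = 0.
  by apply: (triangular_eigen_eq0 d0) => // _ z30; rewrite z30 addr0 in A1.
have a'0 : a' = 0.
  apply: (triangular_eigen_eq0 d0) => // [z30|z20 _].
    by rewrite z30 addr0 in B2.
  by rewrite z20 addr0 in B1.
rewrite a0 a'0 !(mul0r, add0r, addr0, sub0r, oppr0) in E1 E2 E3 B1.
have x30 : x3 = 0 by apply: oppr_inj; rewrite -E2 B1 oppr0.
have dE : det3 x1 x2 x3 y1 y2 y3 z1 z2 z3 = (x2 * y3) * (y3 - x2).
  by rewrite E1 B1 E3 x30 /det3; ring.
by move: d0; rewrite dE !mulf_eq0 !negb_or => /andP [/andP [? ?] ?].
Qed.

(** * The representatives *)

(** The map [q_v23N1] represents two subcases of [BII] as well as [BIII]. *)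
Local Notation q_BII_1 := (heis_map (- v2 + v3) v2 v1).
Local Notation q_v23N1 := (heis_map v2 v3 (- v1)).
Local Notation q_BIV_7 l := (heis_map v2 (v2 + l *: v3) v1).
Local Notation q_BIV_8 :=
  (heis_map (- (2^-1 : K) *: v3) ((2^-1 : K) *: v2) v1).
Local Notation q_BV := (heis_map v1 v3 v2).
Local Notation q_BVI l := (heis_map v2 (l *: v3) ((l - 1) *: v1)).

Lemma q_BII_1E : q_BII_1 = heis_map (vec 0 (-1) 1) (vec 0 1 0) (vec 1 0 0).
Proof. by vec_simp. Qed.

Lemma q_v23N1E : q_v23N1 = heis_map (vec 0 1 0) (vec 0 0 1) (vec (-1) 0 0).
Proof. by vec_simp. Qed.

Lemma q_BIV_7E l : q_BIV_7 l = heis_map (vec 0 1 0) (vec 0 1 l) (vec 1 0 0).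
Proof. by vec_simp. Qed.

Lemma q_BIV_8E :
  q_BIV_8 = heis_map (vec 0 0 (- 2^-1)) (vec 0 2^-1 0) (vec 1 0 0).
Proof. by vec_simp. Qed.

Lemma q_BVE : q_BV = heis_map (vec 1 0 0) (vec 0 0 1) (vec 0 1 0).
Proof. by vec_simp. Qed.

Lemma q_BVIE l : q_BVI l = heis_map (vec 0 1 0) (vec 0 0 l) (vec (l - 1) 0 0).
Proof. by vec_simp. Qed.

Lemma q_BII_1P : bijective_cocycle (BII vP 0 1 0 0) q_BII_1.
Proof.
by rewrite q_BII_1E; cocycle_calc (-1 : K); rewrite oppr_eq0 oner_eq0.
Qed.

Lemma q_BII_1_lsa : gives_lsa (BII vP 0 1 0 0) q_BII_1 H3'.
Proof. by lsa_calc q_BII_1P; rewrite q_BII_1E; vec_calc; ring. Qed.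

Lemma q_BII_2P : bijective_cocycle (BII vP 0 0 0 1) q_v23N1.
Proof.
by rewrite q_v23N1E; cocycle_calc (-1 : K); rewrite oppr_eq0 oner_eq0.
Qed.

Lemma q_BII_2_lsa : gives_lsa (BII vP 0 0 0 1) q_v23N1 H4'.
Proof. by lsa_calc q_BII_2P; rewrite q_v23N1E; vec_calc; ring. Qed.

Lemma q_BII_3P : bijective_cocycle (BII vP 0 0 0 0) q_v23N1.
Proof.
by rewrite q_v23N1E; cocycle_calc (-1 : K); rewrite oppr_eq0 oner_eq0.
Qed.

Lemma q_BII_3_lsa : gives_lsa (BII vP 0 0 0 0) q_v23N1 H5.
Proof. by lsa_calc q_BII_3P; rewrite q_v23N1E; vec_calc; ring. Qed.

Lemma q_BIIIP : bijective_cocycle (BIII vP 0 0) q_v23N1.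
Proof.
by rewrite q_v23N1E; cocycle_calc (-1 : K); rewrite oppr_eq0 oner_eq0.
Qed.

Lemma q_BIII_lsa : gives_lsa (BIII vP 0 0) q_v23N1 H6.
Proof. by lsa_calc q_BIIIP; rewrite q_v23N1E; vec_calc; ring. Qed.

Lemma q_BIV_7P l : l != 0 -> bijective_cocycle (BIV vP 0 0) (q_BIV_7 l).
Proof. by move=> l0; rewrite q_BIV_7E; cocycle_calc l. Qed.

Lemma q_BIV_7_lsa l : l != 0 -> gives_lsa (BIV vP 0 0) (q_BIV_7 l) (H7 l).
Proof.
by move=> l0; lsa_calc (q_BIV_7P l0); rewrite q_BIV_7E; vec_calc; ring.
Qed.

Lemma q_BVP : bijective_cocycle (BV vP 0 0) q_BV.
Proof.
by rewrite q_BVE; cocycle_calc (-1 : K); rewrite oppr_eq0 oner_eq0.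
Qed.

Lemma q_BV_lsa : gives_lsa (BV vP 0 0) q_BV H9.
Proof. by lsa_calc q_BVP; rewrite q_BVE; vec_calc; ring. Qed.

Lemma q_BVIP l : l != 0 -> l != 1 -> bijective_cocycle (BVI vP 0 0) (q_BVI l).
Proof.
move=> l0 l1; rewrite q_BVIE; cocycle_calc (l * (l - 1)).
by rewrite mulf_neq0 // subr_eq0.
Qed.

Lemma q_BVI_lsa l :
  l != 0 -> l != 1 -> gives_lsa (BVI vP 0 0) (q_BVI l) (H10 l).
Proof.
move=> l0 l1; have l10 : l - 1 != 0 by rewrite subr_eq0.
by lsa_calc (q_BVIP l0 l1); rewrite q_BVIE; vec_calc; field.
Qed.

Section CharNot2.
Hypothesis two_neq0 : (2 : K) != 0.

Lemma q_BIV_8P : bijective_cocycle (BIV vP 0 0) q_BIV_8.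
Proof.
rewrite q_BIV_8E; cocycle_calc (2^-1 * 2^-1 : K).
by rewrite mulf_neq0 ?invr_neq0.
Qed.

Lemma q_BIV_8_lsa : gives_lsa (BIV vP 0 0) q_BIV_8 H8.
Proof. by lsa_calc q_BIV_8P; rewrite q_BIV_8E; vec_calc; ring. Qed.

End CharNot2.

(** * Every bijective cocycle is equivalent to a representative *)

(** In this and the following lemmas, the coordinates of the new basis [E1], [E2]
    are solutions of the equations of the table; those along [e3] adjust
    [q E1] and [q E2] by multiples of [q e3]. *)
Lemma q_BII_1_equiv c c' q : c != 0 -> bijective_cocycle (BII vP 0 c 0 c') q ->
  cocycle_equiv (BII vP 0 c 0 c') q (BII vP 0 1 0 0) q_BII_1.
Proof.
have [x1 [x2 [x3 [y1 [y2 [y3 [z1 [z2 [z3 ->]]]]]]]]] := heis_map_coord vP q.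
move=> c0 qP; have [_ [z1E z20 z30] cy x20 d0] := BII_coord qP.
have y3E : y3 = c' / c * x3 by apply: (mulfI c0); rewrite cy; field.
have D0 : c' * x2 - c * y2 != 0.
  apply: contraNneq d0 => D0; apply/eqP; rewrite y3E.
  by transitivity (x3 * (c' * x2 - c * y2) / c); [field|rewrite D0; ring].
(* The constants solve [E1 E1 = E1 + E2] and [E2 E2 = - E2 E1 = [E1, E2]]. *)
pose d := x2 / (c' * x2 - c * y2).
apply: (heis_cocycle_equiv (a := c^-1) (b := 0)
  (c := (x1 * (c^-1 - d * c' / c) + d * y1) / x2)
  (a' := - (d * c' / c)) (b' := d) (c' := 0)
  qP q_BII_1P q_BII_1_lsa) => [[|[|[]]]//|[|[|[]]]//|||||].
  by rewrite mul0r subr0 !mulf_neq0 ?invr_neq0.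
all: rewrite y3E z1E z20 z30 /d; vec_calc; field; by rewrite ?c0 ?D0 ?x20.
Qed.

Lemma q_BII_2_equiv c' q : c' != 0 -> bijective_cocycle (BII vP 0 0 0 c') q ->
  cocycle_equiv (BII vP 0 0 0 c') q (BII vP 0 0 0 1) q_v23N1.
Proof.
have [x1 [x2 [x3 [y1 [y2 [y3 [z1 [z2 [z3 ->]]]]]]]]] := heis_map_coord vP q.
move=> c0 qP; have [_ [z1E z20 z30] cy x20 d0] := BII_coord qP.
have x30 : x3 = 0 by apply: (mulfI c0); rewrite -cy; ring.
apply: (heis_cocycle_equiv (a := 1) (b := 0) (c := x1 / x2)
  (a' := - y2 / (c' * x2)) (b' := c'^-1)
  (c' := (y1 / c' - y2 * x1 / (c' * x2)) / x2)
  qP q_BII_2P q_BII_2_lsa) => [[|[|[]]]//|[|[|[]]]//|||||].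
  by rewrite mul0r subr0 mul1r invr_neq0.
all: rewrite x30 z1E z20 z30; vec_calc; field; by rewrite ?c0 ?x20.
Qed.

Lemma q_BII_3_equiv q : bijective_cocycle (BII vP 0 0 0 0) q ->
  cocycle_equiv (BII vP 0 0 0 0) q (BII vP 0 0 0 0) q_v23N1.
Proof.
have [x1 [x2 [x3 [y1 [y2 [y3 [z1 [z2 [z3 ->]]]]]]]]] := heis_map_coord vP q.
move=> qP; have [_ [z1E z20 z30] _ x20 d0] := BII_coord qP.
apply: (heis_cocycle_equiv (a := 1) (b := 0) (c := 0)
  (a' := - y2 / x2) (b' := 1) (c' := 0)
  qP q_BII_3P q_BII_3_lsa) => [[|[|[]]]//|[|[|[]]]//|||||].
  by rewrite mul0r subr0 mul1r oner_neq0.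
all: rewrite z1E z20 z30; vec_calc; field; by rewrite ?x20.
Qed.

Lemma q_BIII_equiv q : bijective_cocycle (BIII vP 0 0) q ->
  cocycle_equiv (BIII vP 0 0) q (BIII vP 0 0) q_v23N1.
Proof.
have [x1 [x2 [x3 [y1 [y2 [y3 [z1 [z2 [z3 ->]]]]]]]]] := heis_map_coord vP q.
move=> qP; have [_ [z1E z20 z30] x30 x20 y30] := BIII_coord qP.
apply: (heis_cocycle_equiv (a := y3 / x2) (b := 0)
  (c := (y3 / x2 * x1 - y2) / x2) (a' := 0) (b' := 1) (c' := 0)
  qP q_BIIIP q_BIII_lsa) => [[|[|[]]]//|[|[|[]]]//|||||].
  by rewrite mul0r subr0 mulr1 mulf_neq0 ?invr_neq0.
all: rewrite x30 z1E z20 z30; vec_calc; field; by rewrite ?x20.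
Qed.

Lemma q_BV_equiv q : bijective_cocycle (BV vP 0 0) q ->
  cocycle_equiv (BV vP 0 0) q (BV vP 0 0) q_BV.
Proof.
have [x1 [x2 [x3 [y1 [y2 [y3 [z1 [z2 [z3 ->]]]]]]]]] := heis_map_coord vP q.
move=> qP; have [_ [z1E z2E z30] d0] := BV_coord qP.
(* [E1] is chosen so that the third coordinate of [q E1] vanishes, and [E2] is
   any [p e1 + r e2] for which that of [q E2] does not; the scaling of [E1] is
   the one for which [E2 E2 = E1]. *)
pose D := (x1 * y3 - x3 * y1) * y3 + (x2 * y3 - x3 * y2) * x3.
suff equiv p r : p * x3 + r * y3 != 0 ->
    cocycle_equiv (BV vP 0 0)
      (heis_map (vec x1 x2 x3) (vec y1 y2 y3) (vec z1 z2 z3)) (BV vP 0 0) q_BV.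
  have [x30|x30] := eqVneq x3 0; last first.
    by apply: (equiv 1 0); rewrite mul1r mul0r addr0.
  apply: (equiv 0 1); rewrite x30 mulr0 add0r mul1r.
  by apply: contraNneq d0 => ->; rewrite x30 !mulr0 addr0.
move=> t0; pose t := p * x3 + r * y3.
apply: (heis_cocycle_equiv (a := t ^+ 2 / D * y3) (b := - (t ^+ 2 / D * x3))
  (c := t * (p * (x1 * y3 - x3 * y1) - r * (x2 * y3 - x3 * y2)) / D)
  (a' := p) (b' := r) (c' := 0)
  qP q_BVP q_BV_lsa) => [[|[|[]]]//|[|[|[]]]//|||||].
  rewrite (_ : _ - _ = t ^+ 3 / D); last by rewrite /t; field.
  by rewrite mulf_neq0 ?invr_neq0 ?expf_neq0.
all: rewrite z1E z2E z30 /t /D; vec_calc; field; exact: d0.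
Qed.

(** The product is [x2], [y2], [x3], [y3] times [v1] on the pairs [e1 e1],
    [e1 e2], [e2 e1], [e2 e2], and [l] is the determinant of this form divided
    by the square of its skew part.  The hypothesis says that [E1 = p e1 + r e2]
    has nonzero square; [E2] is chosen with [E2 E1 = 0] and [E1 E2 = E1 E1]. *)
Lemma q_BIV_7_equiv p r x1 x2 x3 y1 y2 y3 z1 z2 z3 :
  let q := heis_map (vec x1 x2 x3) (vec y1 y2 y3) (vec z1 z2 z3) in
  bijective_cocycle (BIV vP 0 0) q ->
  x2 * p ^+ 2 + (y2 + x3) * p * r + y3 * r ^+ 2 != 0 ->
  exists2 l, l != 0 & cocycle_equiv (BIV vP 0 0) q (BIV vP 0 0) (q_BIV_7 l).
Proof.
move=> q qP k0; have [_ [z1E z20 z30] w0 d0] := BIV_coord qP.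
have l0 : (x2 * y3 - x3 * y2) / (y2 - x3) ^+ 2 != 0.
  by rewrite mulf_neq0 ?invr_neq0 ?expf_neq0.
exists ((x2 * y3 - x3 * y2) / (y2 - x3) ^+ 2) => //.
apply: (heis_cocycle_equiv (a := p) (b := r) (c := 0)
  (a' := - (x3 * p + y3 * r) / (y2 - x3)) (b' := (x2 * p + y2 * r) / (y2 - x3))
  (c' := 0)
  qP (q_BIV_7P l0) (q_BIV_7_lsa l0)) => [[|[|[]]]//|[|[|[]]]//|||||].
  rewrite (_ : _ - _ = (x2 * p ^+ 2 + (y2 + x3) * p * r + y3 * r ^+ 2)
    / (y2 - x3)); last by field.
  by rewrite mulf_neq0 ?invr_neq0.
all: rewrite /q z1E z20 z30; vec_calc; field; exact: w0.
Qed.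

(** The case in which the form is alternating. *)
Lemma q_BIV_8_equiv x1 x2 x3 y1 y2 y3 z1 z2 z3 :
  let q := heis_map (vec x1 x2 x3) (vec y1 y2 y3) (vec z1 z2 z3) in
  (2 : K) != 0 -> bijective_cocycle (BIV vP 0 0) q ->
  x2 = 0 -> y3 = 0 -> y2 + x3 = 0 ->
  cocycle_equiv (BIV vP 0 0) q (BIV vP 0 0) q_BIV_8.
Proof.
move=> q two0 qP x20 y30 /eqP; rewrite addr_eq0 => /eqP y2E.
have [_ [z1E z20 z30] w0 d0] := BIV_coord qP.
apply: (heis_cocycle_equiv (a := 1) (b := 0) (c := 0)
  (a' := 0) (b' := 1) (c' := 0)
  qP (q_BIV_8P two0) (q_BIV_8_lsa two0)) => [[|[|[]]]//|[|[|[]]]//|||||].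
  by rewrite mul0r subr0 mul1r oner_neq0.
all: by rewrite /q x20 y30 z1E z20 z30 y2E; vec_calc; field.
Qed.

(** The parameter [y3 / x2] is the ratio of the products [e1 e2] and [e2 e1]. *)
Lemma q_BVI_equiv q : bijective_cocycle (BVI vP 0 0) q ->
  exists2 l, (l != 0) && (l != 1)
    & cocycle_equiv (BVI vP 0 0) q (BVI vP 0 0) (q_BVI l).
Proof.
have [x1 [x2 [x3 [y1 [y2 [y3 [z1 [z2 [z3 ->]]]]]]]]] := heis_map_coord vP q.
move=> qP; have [_ [z1E z20 z30] x30 [x20 y30] xy0] := BVI_coord qP.
have l0 : y3 / x2 != 0 by rewrite mulf_neq0 ?invr_neq0.
have l1 : y3 / x2 != 1.
  by apply: contraNneq xy0 => e; rewrite -[y3](divfK x20) e mul1r subrr.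
exists (y3 / x2); first by rewrite l0.
apply: (heis_cocycle_equiv (a := 1) (b := 0)
  (c := (y2 * x2 / y3 - x1) / (y3 - x2)) (a' := 0) (b' := 1) (c' := 0)
  qP (q_BVIP l0 l1) (q_BVI_lsa l0 l1)) => [[|[|[]]]//|[|[|[]]]//|||||].
  by rewrite mul0r subr0 mul1r oner_neq0.
all: rewrite x30 z1E z20 z30; vec_calc; field.
all: by rewrite ?x20 ?y30 ?mulN1r ?xy0.
Qed.

(** * Distinct parameters give nonequivalent cocycles *)

Lemma q_BIV_7_equiv_eq (l l' : K) : l != 0 -> l' != 0 ->
  cocycle_equiv (BIV vP 0 0) (q_BIV_7 l) (BIV vP 0 0) (q_BIV_7 l') -> l = l'.
Proof.
move=> l0 l'0 /(table_equiv (q_BIV_7P l0) (q_BIV_7P l'0)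
  (q_BIV_7_lsa l0) (q_BIV_7_lsa l'0)) [a [b [c [a' [b' [c' [d0 TM]]]]]]].
move: (TM e1 e1) (TM e1 e2) (TM e2 e1) (TM e2 e2).
rewrite /H7 !heis_map1 !heis_map2 e1E e2E !table_mul_hvec;
  do ?by rewrite ?hvec0; case=> [|[|[]]].
rewrite !hvecE !heis_map_hvec !hvecE.
move=> /hvec_inj [_ _ t11] /hvec_inj [_ _ t12] /hvec_inj [_ _ t21].
move=> /hvec_inj [_ _ t22].
rewrite !(mulr0, mul0r, mulr1, mul1r, addr0, add0r) in t11 t12 t21 t22.
(* Compare the determinants of the two forms. *)
have d2_neq0 := mulf_neq0 d0 d0; apply: (mulfI d2_neq0).
transitivity ((a * a + a * b + b * b * l) * (a' * a' + a' * b' + b' * b' * l)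
  - (a * a' + a * b' + b * b' * l) * (a' * a + a' * b + b' * b * l));
  first by ring.
by rewrite -t11 -t12 -t21 -t22; ring.
Qed.

(** All squares vanish in [H8], unlike in [H7]. *)
Lemma q_BIV_8_equiv_7 (l : K) : (2 : K) != 0 -> l != 0 ->
  ~ cocycle_equiv (BIV vP 0 0) q_BIV_8 (BIV vP 0 0) (q_BIV_7 l).
Proof.
move=> two0 l0 /(table_equiv (q_BIV_8P two0) (q_BIV_7P l0)
  (q_BIV_8_lsa two0) (q_BIV_7_lsa l0)) [a [b [c [a' [b' [c' [d0 TM]]]]]]].
move: (TM e1 e1).
rewrite /H7 /H8 !heis_map1 e1E !table_mul_hvec;
  do ?by rewrite ?hvec0; case=> [|[|[]]].
rewrite !hvecE !heis_map_hvec !hvecE => /hvec_inj [_ _ t11].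
rewrite !(mulr0, mul0r, mulr1, mul1r, addr0, add0r) in t11.
by move/eqP: d0; apply; rewrite t11; ring.
Qed.

Lemma q_BIV_7_equiv_8 (l : K) : (2 : K) != 0 -> l != 0 ->
  ~ cocycle_equiv (BIV vP 0 0) (q_BIV_7 l) (BIV vP 0 0) q_BIV_8.
Proof.
move=> two0 l0 /(table_equiv (q_BIV_7P l0) (q_BIV_8P two0)
  (q_BIV_7_lsa l0) (q_BIV_8_lsa two0)) [a [b [c [a' [b' [c' [d0 TM]]]]]]].
(* The image of this vector is a nonzero multiple of [e1] modulo [e3]. *)
have := TM (hvec b' (- b) 0) (hvec b' (- b) 0).
rewrite /H7 /H8 !heis_map_hvec !hvecE !table_mul_hvec;
  do ?by rewrite ?hvec0; case=> [|[|[]]].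
rewrite !hvecE !heis_map_hvec !hvecE => /hvec_inj [_ _ tu].
have /negP := mulf_neq0 d0 d0; apply; apply/eqP.
move/eqP: tu; rewrite -subr_eq0 => /eqP tu.
by rewrite -[RHS]oppr0 -tu; ring.
Qed.

Lemma q_BVI_equiv_eq (l l' : K) : l != 0 -> l != 1 -> l' != 0 -> l' != 1 ->
  cocycle_equiv (BVI vP 0 0) (q_BVI l) (BVI vP 0 0) (q_BVI l') -> l = l'.
Proof.
move=> l0 l1 l'0 l'1 /(table_equiv (q_BVIP l0 l1) (q_BVIP l'0 l'1)
  (q_BVI_lsa l0 l1) (q_BVI_lsa l'0 l'1))
  [a [b [c [a' [b' [c' [d0 TM]]]]]]].
move: (TM e1 e1) (TM e2 e1).
rewrite /H10 !heis_map1 !heis_map2 e1E e2E !table_mul_hvec;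
  do ?by rewrite ?hvec0; case=> [|[|[]]].
rewrite !hvecE !heis_map_hvec !hvecE.
move=> /hvec_inj [t11 _ _] /hvec_inj [_ _ t21].
rewrite !(mulr0, mul0r, mulr1, mul1r, addr0, add0r) in t11 t21.
(* [e1] has square zero, which forces its image to have no [e2] component. *)
have b0 : b = 0.
  move/esym/eqP: t11; rewrite mulf_eq0 (negPf l0) orbF mulf_eq0 orbb.
  by move/eqP.
rewrite b0 !(mulr0, mul0r, add0r, subr0) in t21 d0.
have : (l' - 1)^-1 = (l - 1)^-1.
  by apply: (mulIf d0); rewrite t21; ring.
by move/invr_inj/addIr.
Qed.

(** * Existence and classification *)

Lemma BII_bijective_cocycle_iff a c a' c' :
  (exists q, bijective_cocycle (BII vP a c a' c') q) <->
  [\/ rep_equiv (BII vP a c a' c') (BII vP 0 1 0 0),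
      rep_equiv (BII vP a c a' c') (BII vP 0 0 0 1)
    | rep_equiv (BII vP a c a' c') (BII vP 0 0 0 0)].
Proof.
split=> [[q qP]|]; last first.
  by case=> /rep_equiv_bijective_cocycle; apply;
    [exact: q_BII_1P|exact: q_BII_2P|exact: q_BII_3P].
have [a0 a'0] : a = 0 /\ a' = 0.
  move: (qP).
  have [x1 [x2 [x3 [y1 [y2 [y3 [z1 [z2 [z3 ->]]]]]]]]] := heis_map_coord vP q.
  by case/BII_coord.
rewrite a0 a'0 in qP *.
have [c0|c0] := eqVneq c 0; last first.
  by apply: Or31; apply: cocycle_equivW (q_BII_1_equiv c0 qP).
rewrite c0 in qP *; have [c'0|c'0] := eqVneq c' 0; last first.
  by apply: Or32; apply: cocycle_equivW (q_BII_2_equiv c'0 qP).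
by apply: Or33; rewrite c'0; apply: rep_equiv_refl.
Qed.

Lemma BIII_bijective_cocycle_iff a a' :
  (exists q, bijective_cocycle (BIII vP a a') q) <->
  rep_equiv (BIII vP a a') (BIII vP 0 0).
Proof.
split=> [[q]|/rep_equiv_bijective_cocycle]; last by apply; exact: q_BIIIP.
have [x1 [x2 [x3 [y1 [y2 [y3 [z1 [z2 [z3 ->]]]]]]]]] := heis_map_coord vP q.
by case/BIII_coord=> -[-> ->] *; apply: rep_equiv_refl.
Qed.

Lemma BIV_bijective_cocycle_iff a a' :
  (exists q, bijective_cocycle (BIV vP a a') q) <->
  rep_equiv (BIV vP a a') (BIV vP 0 0).
Proof.
split=> [[q]|/rep_equiv_bijective_cocycle].
  have [x1 [x2 [x3 [y1 [y2 [y3 [z1 [z2 [z3 ->]]]]]]]]] := heis_map_coord vP q.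
  by case/BIV_coord=> -[-> ->] *; apply: rep_equiv_refl.
by apply; apply: (q_BIV_7P (l := 1)); rewrite oner_neq0.
Qed.

Lemma BV_bijective_cocycle_iff a a' :
  (exists q, bijective_cocycle (BV vP a a') q) <->
  rep_equiv (BV vP a a') (BV vP 0 0).
Proof.
split=> [[q]|/rep_equiv_bijective_cocycle]; last by apply; exact: q_BVP.
have [x1 [x2 [x3 [y1 [y2 [y3 [z1 [z2 [z3 ->]]]]]]]]] := heis_map_coord vP q.
by case/BV_coord=> -[-> ->] *; apply: rep_equiv_refl.
Qed.

Lemma BVI_bijective_cocycle_iff a a' : (2 : K) != 0 ->
  (exists q, bijective_cocycle (BVI vP a a') q) <->
  rep_equiv (BVI vP a a') (BVI vP 0 0).
Proof.
move=> two0; split=> [[q]|/rep_equiv_bijective_cocycle].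
  have [x1 [x2 [x3 [y1 [y2 [y3 [z1 [z2 [z3 ->]]]]]]]]] := heis_map_coord vP q.
  by case/BVI_coord=> -[-> ->] *; apply: rep_equiv_refl.
(* [-1] is an admissible parameter: it is not [1] because [2 <> 0]. *)
apply; apply: (q_BVIP (l := -1)); first by rewrite oppr_eq0 oner_neq0.
by rewrite -subr_eq0 -opprD oppr_eq0.
Qed.

Lemma BIV_classification : (2 : K) != 0 ->
  cocycle_classification (BIV vP 0 0)
    (fun q => (exists2 l : K, l != 0 & q = q_BIV_7 l) \/ q = q_BIV_8).
Proof.
move=> two0; split=> [q [[l l0 ->]|->]|q|q q' [[l l0 ->]|->] [[l' l'0 ->]|->]].
- exact: q_BIV_7P.
- exact: q_BIV_8P.
- have [x1 [x2 [x3 [y1 [y2 [y3 [z1 [z2 [z3 ->]]]]]]]]] := heis_map_coord vP q.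
  move=> qP; have equiv7 p r := q_BIV_7_equiv (p := p) (r := r) qP.
  (* If [e1], [e2] and [e1 + e2] have square zero, the form is alternating. *)
  have [x20|x20] := eqVneq x2 0; last first.
    have [|l l0 ql] := equiv7 1 0; last first.
      by exists (q_BIV_7 l) => //; left; exists l.
    by rewrite expr1n expr0n !mulr0 !mulr1 !addr0.
  have [y30|y30] := eqVneq y3 0; last first.
    have [|l l0 ql] := equiv7 0 1; last first.
      by exists (q_BIV_7 l) => //; left; exists l.
    by rewrite expr1n expr0n !mulr0 mul0r !mulr1 !add0r.
  have [yx0|yx0] := eqVneq (y2 + x3) 0; last first.
    have [|l l0 ql] := equiv7 1 1; last first.
      by exists (q_BIV_7 l) => //; left; exists l.
    by rewrite x20 y30 !mul0r !mulr1 add0r addr0.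
  by exists q_BIV_8; [right|exact: q_BIV_8_equiv].
- by move/(q_BIV_7_equiv_eq l0 l'0) => ->.
- by move/(q_BIV_7_equiv_8 two0 l0).
- by move/(q_BIV_8_equiv_7 two0 l'0).
- by [].
Qed.

Lemma BVI_classification :
  cocycle_classification (BVI vP 0 0)
    (fun q => exists2 l : K, (l != 0) && (l != 1) & q = q_BVI l).
Proof.
split=> [q [l /andP [l0 l1] ->]|q qP|q q' [l /andP [l0 l1] ->]].
- exact: q_BVIP.
- have [l l01 ql] := q_BVI_equiv qP.
  by exists (q_BVI l) => //; exists l.
- by move=> [l' /andP [l'0 l'1] ->] /(q_BVI_equiv_eq l0 l1 l'0 l'1) ->.
Qed.

End Classification.

Theorem proposition3p4 (R : realType) (V : vectType R[i]) (v1 v2 v3 : V)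
    (vP : basis_of fullv [tuple v1; v2; v3]) :
  [/\ forall a b c a' b' c' : R[i],
        ~ (exists q, bijective_cocycle (BI vP a b c a' b' c') q),
      [/\ forall a c a' c' : R[i],
            (exists q, bijective_cocycle (BII vP a c a' c') q) <->
            [\/ rep_equiv (BII vP a c a' c') (BII vP 0 1 0 0),
                rep_equiv (BII vP a c a' c') (BII vP 0 0 0 1)
              | rep_equiv (BII vP a c a' c') (BII vP 0 0 0 0)],
          (let f := BII vP 0 1 0 0 in
           let q := heis_map (- v2 + v3) v2 v1 in
           [/\ cocycle_classification f (fun q' => q' = q),
               gives_lsa f q H3'
             & lsa_isomorphic (@H3' R[i]) (@H3 R[i])]),
          (let f := BII vP 0 0 0 1 in
           let q := heis_map v2 v3 (- v1) in
           [/\ cocycle_classification f (fun q' => q' = q),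
               gives_lsa f q H4'
             & lsa_isomorphic (@H4' R[i]) (@H4 R[i])])
        & (let f := BII vP 0 0 0 0 in
           let q := heis_map v2 v3 (- v1) in
           cocycle_classification f (fun q' => q' = q) /\
           gives_lsa f q H5)],
      (forall a a' : R[i],
         (exists q, bijective_cocycle (BIII vP a a') q) <->
         rep_equiv (BIII vP a a') (BIII vP 0 0)) /\
      (let f := BIII vP 0 0 in
       let q := heis_map v2 v3 (- v1) in
       cocycle_classification f (fun q' => q' = q) /\
       gives_lsa f q H6),
      (forall a a' : R[i],
         (exists q, bijective_cocycle (BIV vP a a') q) <->
         rep_equiv (BIV vP a a') (BIV vP 0 0)) /\
      (let f := BIV vP 0 0 in
       let q_ (l : R[i]) := heis_map v2 (v2 + l *: v3) v1 in
       let q := heis_map (- (2^-1 : R[i]) *: v3) ((2^-1 : R[i]) *: v2) v1 in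
       [/\ cocycle_classification f
             (fun q' => (exists2 l : R[i], l != 0 & q' = q_ l) \/ q' = q),
           forall l : R[i], l != 0 -> gives_lsa f (q_ l) (H7 l)
         & gives_lsa f q H8])
    & ((forall a a' : R[i],
          (exists q, bijective_cocycle (BV vP a a') q) <->
          rep_equiv (BV vP a a') (BV vP 0 0)) /\
       (let f := BV vP 0 0 in
        let q := heis_map v1 v3 v2 in
        cocycle_classification f (fun q' => q' = q) /\
        gives_lsa f q H9)) /\
      ((forall a a' : R[i],
          (exists q, bijective_cocycle (BVI vP a a') q) <->
          rep_equiv (BVI vP a a') (BVI vP 0 0)) /\
       (let f := BVI vP 0 0 in
        let q_ (l : R[i]) := heis_map v2 (l *: v3) ((l - 1) *: v1) in
        cocycle_classification f
          (fun q' => exists2 l : R[i], (l != 0) && (l != 1) & q' = q_ l) /\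
        (forall l : R[i], l != 0 -> l != 1 -> gives_lsa f (q_ l) (H10 l))))].
Proof.
have two0 : (2 : R[i]) != 0 by rewrite Num.Theory.pnatr_eq0.
split.
- by move=> a b c a' b' c' [q]; apply: BI_no_bijective_cocycle.
- split; [exact: BII_bijective_cocycle_iff|split|split|split].
  + by apply: cocycle_classification1 (q_BII_1P vP) _ => q;
    apply: q_BII_1_equiv (oner_neq0 _).
  + exact: q_BII_1_lsa.
  + exact: H3'_isomorphic_H3.
  + by apply: cocycle_classification1 (q_BII_2P vP) _ => q;
    apply: q_BII_2_equiv (oner_neq0 _).
  + exact: q_BII_2_lsa.
  + exact: H4'_isomorphic_H4.
  + by apply: cocycle_classification1 (q_BII_3P vP) _ => q;
    apply: q_BII_3_equiv.
  + exact: q_BII_3_lsa.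
- split; [exact: BIII_bijective_cocycle_iff|split].
  + by apply: cocycle_classification1 (q_BIIIP vP) _ => q; apply: q_BIII_equiv.
  + exact: q_BIII_lsa.
- split; [exact: BIV_bijective_cocycle_iff|split].
  + exact: BIV_classification.
  + by move=> l; apply: q_BIV_7_lsa.
  + exact: q_BIV_8_lsa.
- split; split; [exact: BV_bijective_cocycle_iff|split| |split].
  + by apply: cocycle_classification1 (q_BVP vP) _ => q; apply: q_BV_equiv.
  + exact: q_BV_lsa.
  + by move=> a a'; apply: BVI_bijective_cocycle_iff.
  + exact: BVI_classification.
  + by move=> l; apply: q_BVI_lsa.
Qed.
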